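(* There is a universal constant $C>0$ such that for every (nonempty) family $\mathcal{P}$ of probability distributions on a common measurable space and every integer $n\ge2$, $$\log\bigl(1+\chi^2(\mathcal{P},n)\bigr)\ \le\ C\Bigl(\sum_{k=1}^{\lfloor \mathsf{C}_{\chi^2}(\mathcal{P})\rfloor+1}\min\{\mathsf{D}_k(\mathcal{P}),\log n\}\;+\;\bigl(\mathsf{C}_{\chi^2}(\mathcal{P})+1\bigr)\,\log_+\!\bigl(\log \mathsf{C}_{\chi^2}(\mathcal{P})\bigr)\Bigr),$$ where $\log_+(x):=\log(\max\{x,e\})$, and $\chi^2(\mathcal{P},n)$, $\mathsf{C}_{\chi^2}(\mathcal{P})$, $\mathsf{D}_k(\mathcal{P})$ are the quantities defined in the context.
   Context: All logarithms are natural. For probability measures $P,Q$ on the same space, $\chi^2(P\|Q)=\int \frac{(dP-dQ)^2}{dQ}$ (equal to $+\infty$ if $P\not\ll Q$), $H^2(P,Q)=\int(\sqrt{dP}-\sqrt{dQ})^2$, and $D_{1/2}(P,Q)=-2\log\bigl(1-\tfrac{H^2(P,Q)}{2}\bigr)\in[0,\infty]$ (Rényi divergence of order $1/2$). Given $P_1,\dots,P_m\in\mathcal{P}$, the permutation mixture is $\mathbb{P}_m=\frac{1}{m!}\sum_{\pi\in S_m}\bigotimes_{i=1}^m P_{\pi(i)}$ and its i.i.d. mean-field approximation is $\mathbb{Q}_m=\bigl(\frac1m\sum_{i=1}^m P_i\bigr)^{\otimes m}$. Define $$\chi^2(\mathcal{P},n)=\max_{m\le n}\ \sup_{P_1,\dots,P_m\in\mathcal{P}}\chi^2(\mathbb{P}_m\|\mathbb{Q}_m).$$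 The $\chi^2$ channel capacity is $$\mathsf{C}_{\chi^2}(\mathcal{P})=\sup_\rho\ \mathbb{E}_{\theta\sim\rho}\bigl[\chi^2\bigl(P_\theta\,\|\,\mathbb{E}_{\theta'\sim\rho}[P_{\theta'}]\bigr)\bigr],$$ where $(P_\theta)_\theta=\mathcal{P}$ is a parametrization of $\mathcal{P}$ and $\rho$ ranges over prior distributions of $\theta$. The Rényi partition diameter of order $k\in\mathbb{N}$, $k\ge1$, is $$\mathsf{D}_k(\mathcal{P})=\inf_{\mathcal{P}=\bigsqcup_{i=1}^k\mathcal{P}_i}\ \max_{i\in[k]}\ \sup_{P,Q\in\mathcal{P}_i}D_{1/2}(P,Q),$$ the infimum being over partitions of $\mathcal{P}$ into $k$ (possibly empty) subclasses, an empty class having diameter $0$. If $\log\mathsf{C}_{\chi^2}(\mathcal P)$ is less than $e$ (including $-\infty$), then $\log_+(\log\mathsf{C}_{\chi^2}(\mathcal P))=1$. *)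

(* Defs.v *)
From HB Require Import structures.
From mathcomp Require Import all_boot all_order all_algebra all_fingroup.
From mathcomp Require Import all_classical all_reals all_analysis
  measurable_realfun.

Set Implicit Arguments.
Unset Strict Implicit.
Unset Printing Implicit Defensive.

Import Order.TTheory GRing.Theory Num.Theory.
Import numFieldNormedType.Exports.

Local Open Scope classical_set_scope.
Local Open Scope ring_scope.
Local Open Scope ereal_scope.

HB.instance Definition _ d (T : measurableType d) (R : realType)
  (P Q : probability T R) := Measure.on (measure_add P Q).

Section measure_add_finite.
Context d (T : measurableType d) (R : realType) (P Q : probability T R).

Let measure_add_fin : fin_num_fun (measure_add P Q).
Proof. by move=> A mA; rewrite measure_addE fin_numD !fin_num_measure. Qed.

HB.instance Definition _ :=
  Measure_isFinite.Build _ _ _ (measure_add P Q) measure_add_fin.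

End measure_add_finite.

Section divergences.
Context d (T : measurableType d) (R : realType).
Implicit Types P Q : probability T R.

Definition chi2_div P Q : \bar R :=
  if `[< P `<< Q >] then
    \int[Q]_x ((Radon_Nikodym (charge_of_finite_measure P) Q x - 1) ^+ 2)
  else +oo.

(* The dominating measure is P + Q. *)
Definition hellinger2 P Q : \bar R :=
  let mu := measure_add P Q in
  let p := Radon_Nikodym (charge_of_finite_measure P) mu in
  let q := Radon_Nikodym (charge_of_finite_measure Q) mu in
  \int[mu]_x ((Num.sqrt (fine (p x)) - Num.sqrt (fine (q x))) ^+ 2)%:E.

(* [lne 0 = -oo], so the value is [+oo] when P and Q are mutually singular. *)
Definition renyi_half P Q : \bar R :=
  (- 2)%:E * lne (1 - hellinger2 P Q * 2^-1%:E).

End divergences.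

(* [i0] only witnesses that the index type is nonempty. *)
Definition uniform_mixture d (T : measurableType d) (R : realType) (I : finType)
    (i0 : I) (P : I -> probability T R) (A : set T) : \bar R :=
  (#|I|%:R^-1)%:E * \sum_(i : I) P i A.

Section uniform_mixture_probability.
Context d (T : measurableType d) (R : realType) (I : finType) (i0 : I).
Variable P : I -> probability T R.

Local Notation mix := (uniform_mixture i0 P).

Let mix0 : mix set0 = 0.
Proof. by rewrite /uniform_mixture big1 ?mule0. Qed.

Let mix_ge0 A : 0 <= mix A.
Proof. by apply: mule_ge0; [rewrite lee_fin invr_ge0|exact: sume_ge0]. Qed.

Let mix_sigma_additive : semi_sigma_additive mix.
Proof.
move=> F mF tF mUF.
rewrite [X in X @ _ --> _](_ : _ = fun n : nat => (#|I|%:R^-1)%:E *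
    \sum_(i : I) \sum_(0 <= k < n) P i (F k)); last first.
  apply/funext => n; rewrite exchange_big/=.
  by rewrite ge0_sume_distrr// => k _; exact: sume_ge0.
apply: cvgeZl => //; apply: cvg_nnesum => i _.
  by apply: nearW => n; exact: sume_ge0.
exact: measure_semi_sigma_additive.
Qed.

HB.instance Definition _ :=
  isMeasure.Build _ _ _ mix mix0 mix_ge0 mix_sigma_additive.

Let mix_setT : mix setT = 1.
Proof.
rewrite /uniform_mixture; under eq_bigr do rewrite probability_setT.
rewrite sumEFin -EFinM sumr_const mulVf// pnatr_eq0 -lt0n.
by apply/card_gt0P; exists i0.
Qed.

HB.instance Definition _ :=
  Measure_isProbability.Build _ _ _ mix mix_setT.

End uniform_mixture_probability.

Definition tuple_cons d (T : measurableType d) n (x : T * n.-tuple T) :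
  n.+1.-tuple T := [tuple of x.1 :: x.2].

Lemma measurable_tuple_cons d (T : measurableType d) n :
  measurable_fun [set: T * n.-tuple T] (@tuple_cons d T n).
Proof. exact: measurable_cons. Qed.

HB.instance Definition _ d (T : measurableType d) n :=
  isMeasurableFun.Build _ _ _ _ (@tuple_cons d T n)
    (@measurable_tuple_cons d T n).

Fixpoint product_prob d (T : measurableType d) (R : realType) (n : nat) :
    ('I_n -> probability T R) -> probability (n.-tuple T) R :=
  match n with
  | 0 => fun=> \d_[tuple]
  | n'.+1 => fun P => distribution
      (P ord0 \x product_prob (fun i => P (lift ord0 i))) (@tuple_cons d T n')
  end.

(* This characterizes [product_prob P], boxes being a generating pi-system. *)
Lemma product_prob_box d (T : measurableType d) (R : realType) (n : nat)
    (P : 'I_n -> probability T R) (A : 'I_n -> set T) :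
  (forall i, measurable (A i)) ->
  product_prob P [set t | forall i, A i (tnth t i)] = \prod_(i < n) P i (A i).
Proof.
elim: n => [|n IHn] in P A *; move=> mA.
  rewrite big_ord0 /= diracE mem_set//=; by case.
rewrite big_ord_recl /= -IHn// -product_measure1E//; last first.
  rewrite (_ : mkset _ = \bigcap_(i in [set: 'I_n])
      ((fun t : n.-tuple T => tnth t i) @^-1` A (lift ord0 i))); last first.
    by apply/seteqP; split=> t /= h i => [_|]; exact: h.
  apply: fin_bigcap_measurable => // i _; rewrite -[X in measurable X]setTI.
  exact: measurable_tnth.
rewrite /distribution /pushforward /=; congr (_ _).
apply/seteqP; split => -[x t] /=.
  move=> h; split; first exact: (h ord0).
  by move=> i; have := h (lift ord0 i); rewrite tnthS.
move=> [hx ht] i; case: (unliftP ord0 i) => [j ->|->//].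
by rewrite tnthS; exact: ht.
Qed.

Section permutation_mixture.
Context d (T : measurableType d) (R : realType).

Definition perm_mixture m (P : 'I_m -> probability T R) :
    probability (m.-tuple T) R :=
  uniform_mixture (1%g : 'S_m)
    (fun s : 'S_m => product_prob (fun i => P (s i))).

Definition mean_field m (P : 'I_m.+1 -> probability T R) :
    probability (m.+1.-tuple T) R :=
  product_prob (fun=> uniform_mixture ord0 P).

(* The outer maximum is over the sample sizes m.+1 = 1, ..., n. *)
Definition chi2_family (F : set (probability T R)) (n : nat) : \bar R :=
  \big[maxe/-oo]_(m < n) ereal_sup
    [set chi2_div (perm_mixture P) (mean_field P) |
       P in [set P : 'I_m.+1 -> probability T R | forall i, F (P i)]].

End permutation_mixture.

Definition prior_mean d d' (Theta : measurableType d') (T : measurableType d)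
    (R : realType) (rho : probability Theta R)
    (P : {mfun Theta >-> pprobability T R}) (A : set T) : \bar R :=
  \int[rho]_theta (P theta : probability T R) A.

Section prior_mean_probability.
Context d d' (Theta : measurableType d') (T : measurableType d) (R : realType).
Variables (rho : probability Theta R) (P : {mfun Theta >-> pprobability T R}).

Local Notation mean := (prior_mean rho P).

Let mP (A : set T) : measurable A ->
  measurable_fun setT (fun theta => (P theta : probability T R) A).
Proof.
exact: (measurable_kernel (kprobability (measurable_funPT P))).
Qed.

Let mean0 : mean set0 = 0.
Proof. by rewrite /prior_mean integral0_eq. Qed.

Let mean_ge0 A : 0 <= mean A.
Proof. exact: integral_ge0. Qed.

Let mean_sigma_additive : semi_sigma_additive mean.
Proof.
move=> F mF tF mUF; rewrite [X in _ --> X](_ : _ =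
    \int[rho]_theta \sum_(0 <= k <oo) (P theta : probability T R) (F k)).
  rewrite [X in X @ _](_ : _ = fun n => \int[rho]_theta
      \sum_(0 <= k < n) (P theta : probability T R) (F k)); last first.
    by apply/funext => n; rewrite ge0_integral_sum// => k; exact: mP.
  apply: cvg_monotone_convergence => //.
  - by move=> n; apply: emeasurable_sum => k; exact: mP.
  - by move=> n x _; exact: sume_ge0.
  - by move=> x _ m n mn; exact: ereal_nondecreasing_series.
by apply: eq_integral => x _; exact/esym/cvg_lim/measure_semi_sigma_additive.
Qed.

HB.instance Definition _ :=
  isMeasure.Build _ _ _ mean mean0 mean_ge0 mean_sigma_additive.

Let mean_setT : mean setT = 1.
Proof.
rewrite /prior_mean (eq_integral (cst 1)); last first.
  by move=> theta _; exact: probability_setT.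
by rewrite integral_cst// mul1e; exact: probability_setT.
Qed.

HB.instance Definition _ := Measure_isProbability.Build _ _ _ mean mean_setT.

End prior_mean_probability.

Section capacity_diameter.
Context d (T : measurableType d) (R : realType).
Implicit Type F : set (probability T R).

(* The supremum ranges over the measurable parametrizations of F (for the
   sigma-algebra on probability measures generated by the evaluations
   mu |-> mu A) and all priors on the parameter space. The measurability
   condition says that the expectation of the divergence is defined; it is
   vacuous for discrete parameter spaces. *)
Definition chi2_capacity F : \bar R :=
  ereal_sup [set c : \bar R |
    exists (d' : measure_display) (Theta : measurableType d')
      (P : {mfun Theta >-> pprobability T R}) (rho : probability Theta R),
    let div theta := chi2_div (P theta : probability T R) (prior_mean rho P) in
    [/\ range P = F, measurable_fun setT div &
        c = \int[rho]_theta div theta]].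

Definition renyi_diameter F : \bar R :=
  if `[< F = set0 >] then 0
  else ereal_sup [set renyi_half PQ.1 PQ.2 | PQ in F `*` F].

Definition partition_diameter (k : nat) F : \bar R :=
  ereal_inf [set \big[maxe/-oo]_(i < k) renyi_diameter (A i) |
    A in [set A : 'I_k -> set (probability T R) |
      \bigcup_i A i = F /\ trivIset setT A]].

End capacity_diameter.

Section extended_reals.
Variable R : realType.

Definition logp (x : \bar R) : \bar R := lne (maxe x (expR 1)%:E).

(* The sum of the [u k] for k from 1 to floor(x) + 1, where x >= 0. *)
Definition sum_upto_floor1 (x : \bar R) (u : nat -> \bar R) : \bar R :=
  match x with
  | r%:E => \sum_(1 <= k < (Num.truncn r).+2) u k
  | +oo => \sum_(1 <= k <oo) u k
  | -oo => 0
  end.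

End extended_reals.

(* Main.v *)
Require Import Defs.
From HB Require Import structures.
From mathcomp Require Import all_boot all_order all_algebra all_fingroup.
From mathcomp Require Import all_classical all_reals all_analysis
  measurable_realfun.
From mathcomp Require Import cyclic separable spectral cyclotomic complex.
From mathcomp Require Import zify ring lra.

Set Implicit Arguments.
Unset Strict Implicit.
Unset Printing Implicit Defensive.

Import Order.TTheory GRing.Theory Num.Theory.
Import numFieldNormedType.Exports.

(** Let f_i = dP_i / dQ be the densities of P_1, ..., P_N with respect to their
    mean Q, and let A be the matrix of overlaps A_ij = int f_i f_j dQ.  Since
    the density of the permutation mixture with respect to the product of N
    copies of Q is the average over permutations s of prod_i f_(s i)(x_i), its
    second moment is
      1 + chi^2 = perm(A) / N! = (N^N / N!) perm(B),   B = A / N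
    ([chi2_perm_mixture]).  The matrix B is positive semidefinite with
    eigenvalues 1 >= l_1 >= l_2 >= ..., so the theorem is a statement about the
    permanent and the spectrum of B.

    The permanent.  With B = sum_k l_k v_k v_k^* in an orthonormal eigenbasis,
    expanding the rows gives
      perm(B) = sum_a l^a a! |p_a|^2,
    where a runs over the exponents of degree N and p_a is the coefficient of
    y^a in prod_i (sum_k v_k(i) y_k) ([permanent_expand]).  On the torus
    |y_k|^2 = a_k the AM-GM inequality and the orthonormality of the v_k bound
    that product by 1, so the Cauchy estimate is |p_a|^2 prod_k a_k^(a_k) <= 1
    ([coefficient_le]).  After multiplication by N^N / N!, the quotients
    a_k! / a_k^(a_k) cancel up to a linear factor e a_k for each k other than
    the first, and the sum is dominated by a product over the eigenvalues
    l_2, l_3, ... of the series 1 + e sum_j j l^j, truncated at j = N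
    ([weighted_sum_le]).  Such a factor is at most exp(16 l) if l <= 1/2; in
    general its logarithm is O(1 + log N) and O(1 + log (1 / (1 - l))).

    The spectrum.  B is the correlation operator of the channel which draws a
    uniform index I and then X from P_I: for every vector g,
      |g|^2 - g^T B g = sum_i int (g_i - h)^2 dP_i,
    where h(x) is the posterior mean of g_I given X = x
    ([within_variance_sum]).  If P_i and P_j have Hellinger affinity rho, no
    function h is close to g_i under P_i and to g_j under P_j at the same time:
    the two variances add up to at least rho^2 (g_i - g_j)^2 / 2
    ([hellinger_variance]).  Averaging over pairs in the same class of a
    partition into k classes of diameter D, and restricting g to the subspace
    of codimension k where its sums over the classes vanish, gives
    1 - l_(k+1) >= exp(- D) / 2, whatever the sizes of the classes
    ([overlap_form_gap], [min_max_le]).  Hence the k-th eigenvalue after the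
    first one costs O(1 + min (D_k, log n)).

    The count.  The trace of B is at most C + 1, where C is the capacity: the
    uniform prior on P_1, ..., P_N competes in its definition ([capacity_ge],
    [overlap_trace_le]).  So at most 2 (C + 1) eigenvalues exceed 1/2, and the
    others contribute O(C + 1) in total; charging the large ones to the indices
    k = 1, ..., floor(C) + 1, two to each, completes the bound
    ([sum_ln_spectral_factor_le], [permanent_exp_le]). *)

Local Open Scope ring_scope.

(** * Functions on a finite set up to permutation of the arguments *)

Section Occurrences.
Variable n : nat.
Implicit Types (f g : {ffun 'I_n -> 'I_n}) (s t : 'S_n).

Definition occurrences f (k : 'I_n) : nat := #|[pred i | f i == k]|.

Lemma occurrences_le f k : (occurrences f k < n.+1)%N.
Proof. by rewrite ltnS -[X in (_ <= X)%N](card_ord n) max_card. Qed.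

(** The exponent of the monomial [prod_i y_(f i)].  The codomain is finite so
    that one can sum over all exponents. *)
Definition occ f : {ffun 'I_n -> 'I_n.+1} :=
  [ffun k => Ordinal (occurrences_le f k)].

Lemma sum_occ f : (\sum_k occ f k = n)%N.
Proof.
rewrite -[RHS](card_ord n) -sum1_card [RHS](partition_big f predT) //=.
by apply: eq_bigr => k _; rewrite ffunE /= sum1_card.
Qed.

Lemma prod_occ (R : comNzRingType) f (F : 'I_n -> R) :
  \prod_i F (f i) = \prod_k F k ^+ occ f k.
Proof.
rewrite [LHS](partition_big f predT) //=; apply: eq_bigr => k _.
by rewrite ffunE /= -prodr_const; apply: eq_bigr => i /eqP ->.
Qed.

Definition permuted f s : {ffun 'I_n -> 'I_n} := [ffun i => f (s i)].

Lemma permutedM f s t : permuted (permuted f s) t = permuted f (t * s)%g.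
Proof. by apply/ffunP => i; rewrite !ffunE permM. Qed.

Lemma permuted1 f : permuted f 1%g = f.
Proof. by apply/ffunP => i; rewrite !ffunE perm1. Qed.

Lemma occ_permuted f s : occ (permuted f s) = occ f.
Proof.
apply/ffunP => k; apply/val_inj; rewrite !ffunE /= /occurrences.
rewrite -(card_imset _ (@perm_inj _ s)); apply: eq_card => i.
apply/imsetP/idP; rewrite !inE.
  by move=> [j + ->]; rewrite inE ffunE.
by move=> fi; exists (s^-1 i)%g; rewrite ?inE ?ffunE permKV.
Qed.

Lemma occ_eqP f g : occ f = occ g -> exists s, g = permuted f s.
Proof.
move=> fg.
have /tuple_permP[s Es] : perm_eq [tuple g i | i < n] [tuple f i | i < n].
  have h f' k : count_mem k [tuple f' i | i < n] = occ f' k.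
    rewrite count_map ffunE /= /occurrences cardE /enum_mem size_filter.
    by rewrite count_filter; apply: eq_count => i /=; rewrite inE andbT.
  by apply/allP => k _; apply/eqP; rewrite [LHS]h [RHS]h fg.
exists s; apply/ffunP => i; rewrite ffunE.
have /(congr1 (fun u : n.-tuple 'I_n => tnth u i)) := val_inj Es.
by rewrite !tnth_mktuple.
Qed.

Definition symmetries f : nat := #|[set s | permuted f s == f]|.

(** Two permutations carry [f] to the same [g] exactly when they differ by a
    symmetry of [g]. *)
Lemma symmetries_permuted f g :
  occ f = occ g -> #|[set s | permuted f s == g]| = symmetries g.
Proof.
move=> /occ_eqP[t ->].
rewrite /symmetries -[LHS](card_imset _ (@mulIg _ t^-1%g)).
apply: eq_card => s; rewrite !inE; apply/imsetP/eqP => [[u]|fs].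
  by rewrite inE => /eqP E ->; rewrite permutedM mulgKV.
exists (s * t)%g; last by rewrite mulgK.
by rewrite inE -permutedM fs.
Qed.

(** Burnside's count for the single orbit of the functions with the given
    exponent: each permutation of one such function is counted once. *)
Lemma sum_symmetries_le (a : {ffun 'I_n -> 'I_n.+1}) :
  (\sum_(f | occ f == a) symmetries f <= n`!)%N.
Proof.
have [f /eqP fa|h] := pickP (fun f => occ f == a); last by rewrite big_pred0.
rewrite -card_Sn -sum1_card (partition_big (permuted f) (fun g => occ g == a)).
  apply: eq_leq; apply: eq_bigr => g /eqP ga.
  rewrite -(@symmetries_permuted f) ?fa// sum1_card.
  by apply: eq_card => s; rewrite inE.
by move=> s _; rewrite occ_permuted fa.
Qed.

(** A symmetry of [f] permutes every fiber of [f] and is determined by its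
    restrictions to the fibers. *)
Lemma symmetries_le f : (symmetries f <= \prod_k (occ f k)`!)%N.
Proof.
pose S k := [set i | f i == k].
pose r (s : 'S_n) : {ffun 'I_n -> 'S_n} := [ffun k => restr_perm (S k) s].
have sN s k : permuted f s = f -> s \in 'N(S k | 'P)%g.
  move=> fs; apply/astabsP => i; rewrite !inE /= /aperm.
  by rewrite -[in RHS]fs ffunE.
rewrite /symmetries -(@card_in_imset _ _ r); last first.
  move=> s t; rewrite !inE => /eqP fs /eqP ft rst; apply/permP => i.
  have := congr1 (fun u : {ffun 'I_n -> 'S_n} => u (f i) i) rst.
  by rewrite !ffunE !restr_permE ?sN// inE.
have -> : (\prod_k (occ f k)`! = #|family (fun k => [pred s | perm_on (S k) s])|)%N.
  rewrite card_family foldrE big_map big_enum.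
  apply: eq_bigr => k _; rewrite card_perm ffunE /= /occurrences cardsE.
  by congr (_`!); apply: eq_card.
apply/subset_leq_card/fintype.subsetP => _ /imsetP[s _ ->].
by apply/familyP => k; rewrite ffunE inE; exact: restr_perm_on.
Qed.
End Occurrences.

Lemma symmetries_occ n (f g : {ffun 'I_n -> 'I_n}) :
  occ f = occ g -> symmetries f = symmetries g.
Proof.
move=> fg; rewrite -(symmetries_permuted fg) -(symmetries_permuted (esym fg)).
rewrite -(card_imset _ (@invg_inj _)); apply: eq_card => s.
rewrite !inE; apply/imsetP/eqP => [[t]|<-].
  by rewrite inE => /eqP <- ->; rewrite permutedM mulVg permuted1.
by exists s^-1%g; rewrite ?invgK// inE permutedM mulVg permuted1.
Qed.

(** * Cauchy estimates for products of linear forms *)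

Lemma primitive_root_exists (C : numClosedFieldType) (n : nat) :
  (0 < n)%N -> exists z : C, n.-primitive_root z.
Proof.
move=> n0; pose p : {poly C} := 'X^n - 1.
have [r Dp] := closed_field_poly_normal p.
rewrite (monicP _) ?monicXnsubC // scale1r in Dp.
have rn1 : all n.-unity_root r by apply/allP=> z; rewrite -root_prod_XsubC -Dp.
have sz_r : (n < (size r).+1)%N.
  by rewrite -(size_prod_XsubC r id) -Dp size_XnsubC.
have [|z] := hasP (has_prim_root n0 rn1 _ sz_r); last by exists z.
by rewrite -separable_prod_XsubC -Dp separable_Xn_sub_1 // pnatr_eq0 -lt0n.
Qed.

(** Orthogonality of the characters of the cyclic group of order [N], which
    lets finite averages over roots of unity extract coefficients. *)
Lemma geometric_primitive_root (C : numClosedFieldType) (N : nat) (z : C)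
    (a b : nat) : N.-primitive_root z -> (a < N)%N -> (b < N)%N ->
  \sum_(j < N) (z ^+ a / z ^+ b) ^+ j = (a == b)%:R * N%:R.
Proof.
move=> zN aN bN; have N0 := prim_order_gt0 zN.
have z0 : z != 0.
  apply/eqP => z0; move: (prim_expr_order zN).
  by rewrite z0 expr0n gtn_eqF// => /eqP; rewrite eq_sym oner_eq0.
have zE : (z ^+ a == z ^+ b) = (a == b).
  by rewrite (eq_prim_root_expr zN) !modn_small.
have [ab|ab] := eqVneq a b.
  rewrite ab divff ?expf_neq0// (eq_bigr (fun=> 1)) => [|j _]; last by rewrite expr1n.
  by rewrite sumr_const card_ord mul1r.
set x := _ / _; have x1 : x - 1 != 0.
  rewrite subr_eq0 /x; apply: contra ab => /eqP xE.
  by rewrite -zE -[X in X == _](divfK (expf_neq0 b z0)) xE mul1r.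
apply: (mulfI x1); rewrite -subrX1 mul0r mulr0 /x.
by rewrite expr_div_n -!exprM mulnC exprM (prim_expr_order zN) expr1n
  mulnC exprM (prim_expr_order zN) expr1n divr1 subrr.
Qed.

Section Coefficients.
Variables (C : numClosedFieldType) (n : nat) (U : 'I_n -> 'I_n -> C).
Implicit Types f g : {ffun 'I_n -> 'I_n}.

(** With [U k i] the coordinate of the [k]-th vector at [i], the product of the
    linear forms [sum_k U k i * y_k] expands into [sum_f monomial f * y^(occ f)],
    so that [coefficient f] is its coefficient at [y^(occ f)]. *)
Definition monomial f : C := \prod_i U (f i) i.
Definition coefficient f : C := \sum_(g | occ g == occ f) monomial g.

(** Fourier inversion on the torus of radii [r]; order [n.+1] is enough because
    no exponent exceeds [n]. *)
Lemma coefficient_fourier f (r : 'I_n -> C) (z : C) : n.+1.-primitive_root z ->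
  \sum_(e : {ffun 'I_n -> 'I_n.+1})
    (\prod_i \sum_k r k * z ^+ e k * U k i) * \prod_i (z ^+ e (f i))^-1
  = n.+1%:R ^+ n * (\prod_i r (f i) * coefficient f).
Proof.
move=> zN.
have dist (e : {ffun 'I_n -> 'I_n.+1}) :
    (\prod_i \sum_k r k * z ^+ e k * U k i) * \prod_i (z ^+ e (f i))^-1 =
    \sum_(g : {ffun 'I_n -> 'I_n}) \prod_i r (g i) * monomial g *
      (\prod_i z ^+ e (g i) * \prod_i (z ^+ e (f i))^-1).
  rewrite (bigA_distr_bigA (fun i k => r k * z ^+ e k * U k i)) mulr_suml.
  apply: eq_bigr => g _; rewrite !big_split /= !mulrA; congr (_ * _).
  by rewrite mulrAC.
rewrite (eq_bigr _ (fun e _ => dist e)) exchange_big /=.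
have avg g : \sum_(e : {ffun 'I_n -> 'I_n.+1})
    (\prod_i z ^+ e (g i) * \prod_i (z ^+ e (f i))^-1) =
    (occ g == occ f)%:R * n.+1%:R ^+ n.
  have phase (e : {ffun 'I_n -> 'I_n.+1}) :
      \prod_i z ^+ e (g i) * \prod_i (z ^+ e (f i))^-1 =
      \prod_k (z ^+ occ g k / z ^+ occ f k) ^+ e k.
    rewrite (prod_occ g (fun k => z ^+ e k)) (prod_occ f (fun k => (z ^+ e k)^-1)).
    rewrite -big_split; apply: eq_bigr => k _ /=.
    by rewrite expr_div_n exprVn -!exprM mulnC [(e k * _)%N]mulnC.
  rewrite (eq_bigr _ (fun e _ => phase e)).
  rewrite -(bigA_distr_bigA (fun k (j : 'I_n.+1) =>
    (z ^+ occ g k / z ^+ occ f k) ^+ j)) /=.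
  under eq_bigr do rewrite (geometric_primitive_root zN)//.
  rewrite big_split /= prodr_const card_ord; congr (_ * _).
  have [->|gf] := eqVneq (occ g) (occ f).
    by rewrite big1 // => k _; rewrite eqxx.
  have [k kP] : exists k, occ g k != occ f k.
    apply/existsP; apply: contraNT gf => /existsPn h; apply/eqP/ffunP => k.
    by apply/eqP; move: (h k); rewrite negbK.
  by rewrite (bigD1 k) //= (negPf (kP : (_ != _ :> nat))) mul0r.
under eq_bigr do rewrite -mulr_sumr avg.
rewrite /coefficient mulr_sumr mulr_sumr (big_mkcond (fun g => occ g == _)) /=.
apply: eq_bigr => g _; case: ifPn => [/eqP gf|]; rewrite ?mul0r ?mulr0//.
by rewrite mul1r mulrC (prod_occ g) (prod_occ f) gf.
Qed.

Hypothesis U_isometry : forall y : 'I_n -> C,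
  \sum_i `|\sum_k y k * U k i| ^+ 2 = \sum_k `|y k| ^+ 2.

(** Cauchy's estimate at the radii [r k ^+ 2 = occ f k], which minimize the
    bound: there the squared moduli of the linear forms have mean 1, hence a
    product of modulus at most 1 by the AM-GM inequality. *)
Lemma coefficient_le f :
  `|coefficient f| ^+ 2 * \prod_k (occ f k)%:R ^+ occ f k <= 1.
Proof.
have [z zN] := primitive_root_exists C (ltn0Sn n).
have z1 : `|z| = 1.
  apply/eqP; rewrite -(pexpr_eq1 (ltn0Sn n))// -normrX (prim_expr_order zN).
  by rewrite normr1.
pose r k : C := sqrtC (occ f k)%:R.
have r0 k : 0 <= r k by rewrite sqrtC_ge0.
have bound (e : {ffun 'I_n -> 'I_n.+1}) :
    `|\prod_i \sum_k r k * z ^+ e k * U k i| <= 1.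
  rewrite -(@expr_le1 _ 2)// normr_prod -prodrXl.
  have := leif_AGM (A := predT)
    (E := fun i => `|\sum_k r k * z ^+ e k * U k i| ^+ 2).
  case=> [i _|le _]; first by rewrite exprn_ge0.
  apply: (le_trans le); rewrite U_isometry.
  under eq_bigr => k _.
    rewrite normrM normrX z1 expr1n mulr1 ger0_norm// sqrtCK.
    over.
  rewrite -natr_sum sum_occ card_ord.
  by have [->|n0] := eqVneq n 0%N; rewrite ?expr0// divff ?expr1n// pnatr_eq0.
have := coefficient_fourier f r zN => /(congr1 (fun x => `|x|)).
rewrite !normrM normrX ger0_norm// => E.
have : `|\prod_i r (f i)| * `|coefficient f| <= 1.
  rewrite -(ler_pM2l (x := n.+1%:R ^+ n)) ?exprn_gt0// mulr1 -E.
  apply: (le_trans (ler_norm_sum _ _ _)).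
  apply: (@le_trans _ _ (\sum_(e : {ffun 'I_n -> 'I_n.+1}) 1)).
    apply: ler_sum => e _; rewrite normrM [X in _ * X]normr_prod.
    rewrite [X in _ * X]big1 ?mulr1// => i _.
    by rewrite normfV normrX z1 expr1n invr1.
  by rewrite sumr_const card_ffun !card_ord -natrX.
rewrite -(@expr_le1 _ 2) ?mulr_ge0//.
rewrite exprMn mulrC; congr (_ * _ <= _).
rewrite normr_prod -prodrXl -(prod_occ f (fun k => (occ f k)%:R)).
by apply: eq_bigr => i _; rewrite ger0_norm// sqrtCK.
Qed.

End Coefficients.

(** * Permanents of positive semidefinite matrices *)

Definition permanent (R : comNzRingType) (n : nat) (B : 'I_n -> 'I_n -> R) : R :=
  \sum_(s : 'S_n) \prod_i B i (s i).

Section PermanentBound.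
Variables (C : numClosedFieldType) (n : nat) (U : 'I_n -> 'I_n -> C).
Variable lam : 'I_n -> C.
Implicit Types f g : {ffun 'I_n -> 'I_n}.
Local Notation B := (fun i j => \sum_k lam k * (U k i)^* * U k j).

(** The orbit of [f] consists of all functions with the same exponent, and each
    of them is reached once for every symmetry. *)
Lemma orbit_sum f : \sum_(s : 'S_n) monomial U (permuted f s) =
  (symmetries f)%:R * coefficient U f.
Proof.
rewrite (partition_big (permuted f) (fun g => occ g == occ f)) /=; last first.
  by move=> s _; rewrite occ_permuted.
rewrite mulr_sumr; apply: eq_bigr => g /eqP gf.
rewrite (eq_bigr (fun=> monomial U g)); last by move=> s /eqP ->.
rewrite sumr_const -(symmetries_occ gf).
rewrite -(@symmetries_permuted _ f g)//. rewrite mulr_natl; congr (_ *+ _).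
by apply: eq_card => s; rewrite inE.
Qed.

(** Expanding [B] in its eigenvectors writes the permanent as a sum of
    [monomial f] times the orbit sum of [f]; averaging the first factor over the
    orbit as well turns each term into a squared modulus. *)
Lemma permanent_expand :
  n`!%:R * permanent B = \sum_(f : {ffun 'I_n -> 'I_n}) \prod_k lam k ^+ occ f k *
     `|(symmetries f)%:R * coefficient U f| ^+ 2.
Proof.
have permE : permanent B = \sum_(f : {ffun 'I_n -> 'I_n}) \prod_k lam k ^+ occ f k *
    ((monomial U f)^* * ((symmetries f)%:R * coefficient U f)).
  rewrite /permanent.
  have dist (s : 'S_n) : \prod_i B i (s i) = \sum_(f : {ffun 'I_n -> 'I_n})
      \prod_k lam k ^+ occ f k * ((monomial U f)^* * monomial U (permuted f s^-1%g)).
    rewrite (bigA_distr_bigA (fun i k => lam k * (U k i)^* * U k (s i))).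
    apply: eq_bigr => f _; rewrite !big_split /= (prod_occ f) -mulrA /monomial.
    rewrite rmorph_prod; congr (_ * (_ * _)).
    rewrite [RHS](reindex_perm s) /=; apply: eq_bigr => i _.
    by rewrite ffunE permK.
  rewrite (eq_bigr _ (fun s _ => dist s)) exchange_big /=.
  apply: eq_bigr => f _; rewrite -!mulr_sumr -orbit_sum; congr (_ * (_ * _)).
  rewrite [RHS](reindex_inj invg_inj); exact: eq_bigr.
rewrite -card_Sn mulr_natl -sumr_const.
have sym (s : 'S_n) : permanent B =
    \sum_(f : {ffun 'I_n -> 'I_n}) \prod_k lam k ^+ occ f k *
    ((monomial U (permuted f s))^* * ((symmetries f)%:R * coefficient U f)).
  rewrite permE (reindex_onto (fun f => permuted f s)
    (fun f => permuted f s^-1%g)) /=; last first.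
    by move=> f _; rewrite permutedM mulgV permuted1.
  apply: eq_big => [f|f _]; first by rewrite permutedM mulVg permuted1 eqxx.
  rewrite occ_permuted -(@symmetries_occ _ f) ?occ_permuted// /coefficient.
  by rewrite occ_permuted.
rewrite (eq_bigr _ (fun s _ => sym s)) exchange_big /=; apply: eq_bigr => f _.
rewrite -mulr_sumr -mulr_suml -rmorph_sum; congr (_ * _).
rewrite (eq_bigl predT); last by move=> s; rewrite inE.
by rewrite orbit_sum mulrC -normCK.
Qed.

Hypothesis U_isometry : forall y : 'I_n -> C,
  \sum_i `|\sum_k y k * U k i| ^+ 2 = \sum_k `|y k| ^+ 2.
Hypothesis lam_ge0 : forall k, 0 <= lam k.

(** An orbit with exponent [a] has [n`! / prod_k (a k)`!] elements, which turns
    the factor [symmetries f ^+ 2] of the expansion into one factor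
    [prod_k (a k)`!] for each exponent. *)
Lemma permanent_le :
  permanent B <= \sum_(a : {ffun 'I_n -> 'I_n.+1} | (\sum_k a k == n)%N)
    \prod_k (lam k ^+ a k * ((a k)`!%:R / (a k)%:R ^+ a k)).
Proof.
have facn0 : 0 < n`!%:R :> C by rewrite ltr0n fact_gt0.
rewrite -(ler_pM2l facn0) permanent_expand mulr_sumr.
rewrite (partition_big (@occ n) (fun a => \sum_k a k == n)%N) /=; last first.
  by move=> f _; apply/eqP; exact: sum_occ.
apply: ler_sum => a _.
pose w : C := \prod_k (lam k ^+ a k * ((a k)`!%:R / (a k)%:R ^+ a k)).
apply: (@le_trans _ _ (\sum_(f | occ f == a) w * (symmetries f)%:R)).
  apply: ler_sum => f /eqP fa; rewrite /w -fa big_split /= -mulrA.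
  apply: ler_wpM2l; first by apply: prodr_ge0 => k _; rewrite exprn_ge0.
  rewrite normrM normr_nat exprMn expr2 -!mulrA [in leRHS]mulrC.
  apply: ler_wpM2l; rewrite ?ler0n//.
  have pos : 0 < \prod_k (occ f k)%:R ^+ occ f k :> C.
    apply: prodr_gt0 => k _; have [->|k0] := posnP (occ f k); first by rewrite ltr01.
    by rewrite exprn_gt0 // ltr0n.
  rewrite big_split /= prodfV ler_pdivlMr// -mulrA.
  apply: (@le_trans _ _ (symmetries f)%:R).
    by rewrite ler_piMr ?ler0n// coefficient_le.
  by rewrite -natr_prod ler_nat symmetries_le.
rewrite -mulr_sumr mulrC -natr_sum; apply: ler_wpM2r.
  by apply: prodr_ge0 => k _; rewrite !mulr_ge0 ?exprn_ge0 ?invr_ge0 ?exprn_ge0.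
by rewrite ler_nat sum_symmetries_le.
Qed.

End PermanentBound.

(** * Spectral decomposition of real symmetric matrices *)

Lemma nonincreasing_perm (R : realDomainType) n (d : 'I_n -> R) :
  exists s : 'S_n, forall i j : 'I_n, (i <= j)%N -> d (s j) <= d (s i).
Proof.
pose t := [tuple d i | i < n].
have /tuple_permP[s Es] : perm_eq (sort >=%O t) t by rewrite perm_sort.
exists s => i j ij.
have dE k : d (s k) = nth 0 (sort >=%O t) k.
  by rewrite Es -(tnth_nth _ [tuple tnth t (s i) | i < n]) !tnth_mktuple.
rewrite !dE; have st : sorted >=%O (sort >=%O t).
  by apply: sort_sorted => x y; exact: le_total.
have := @sorted_leq_nth _ _ (@ge_trans _ R) (@ge_refl _ R) 0 _ st i j.
by rewrite !inE size_sort size_tuple; apply.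
Qed.

Section Orthonormal.
Variables (C : numClosedFieldType) (n : nat) (U : 'I_n -> 'I_n -> C).
Variable lam : 'I_n -> C.
Hypothesis U_orthonormal : forall k l, \sum_i U k i * (U l i)^* = (k == l)%:R.
Implicit Type c : 'I_n -> C.
Local Notation B := (fun i j => \sum_k lam k * (U k i)^* * U k j).

Lemma orthonormal_coordinate c l :
  \sum_i (\sum_k c k * U k i) * (U l i)^* = c l.
Proof.
under eq_bigr do rewrite mulr_suml.
rewrite exchange_big /= (bigD1 l) //= [X in _ + X]big1 ?addr0 => [|k kl].
  under eq_bigr do rewrite -mulrA.
  by rewrite -mulr_sumr U_orthonormal eqxx mulr1.
under eq_bigr do rewrite -mulrA.
by rewrite -mulr_sumr U_orthonormal (negPf kl) mulr0.
Qed.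

Lemma orthonormal_isometry c :
  \sum_i `|\sum_k c k * U k i| ^+ 2 = \sum_k `|c k| ^+ 2.
Proof.
under eq_bigr => i _ do rewrite normCK rmorph_sum mulr_sumr.
rewrite exchange_big /=; apply: eq_bigr => l _.
under eq_bigr => i _ do rewrite rmorphM mulrCA.
by rewrite -mulr_sumr orthonormal_coordinate normCK mulrC.
Qed.

Lemma orthonormal_form c (y := fun i => \sum_k c k * U k i) :
  \sum_i \sum_j y i * (y j)^* * B i j = \sum_k lam k * `|c k| ^+ 2.
Proof.
transitivity (\sum_k lam k * ((\sum_i y i * (U k i)^*) * (\sum_j y j * (U k j)^*)^*)).
  under eq_bigr => i _ do under eq_bigr => j _ do rewrite mulr_sumr.
  under eq_bigr => i _ do rewrite exchange_big.
  rewrite exchange_big /=; apply: eq_bigr => k _.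
  rewrite mulr_suml mulr_sumr; apply: eq_bigr => i _.
  rewrite rmorph_sum !mulr_sumr; apply: eq_bigr => j _.
  by rewrite rmorphM /= conjCK; ring.
by apply: eq_bigr => k _; rewrite !orthonormal_coordinate normCK.
Qed.

(** The first [k.+1] vectors span a space of dimension greater than the number
    [p] of constraints.  The vanishing of the coordinates after [k] is imposed
    by [n - k.+1] further linear conditions. *)
Lemma vector_in_span_with_constraints p (k : 'I_n) (W : 'I_p -> 'I_n -> C) :
  (p <= k)%N -> exists c,
    [/\ exists l, c l != 0, forall l : 'I_n, (k < l)%N -> c l = 0 &
        forall q, \sum_i W q i * (\sum_l c l * U l i) = 0].
Proof.
move=> pk.
pose M : 'M[C]_(n, p + (n - k.+1)) := \matrix_(l, q)
  match fintype.split q with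
  | inl q => \sum_i W q i * U l i
  | inr r => (nat_of_ord l == (r + k.+1)%N)%:R
  end.
have : kermx M != 0.
  rewrite -mxrank_eq0 mxrank_ker subn_eq0 -ltnNge.
  apply: (leq_ltn_trans (rank_leq_col M)).
  by have := ltn_ord k; lia.
case/rowV0Pn => v /sub_kermxP vM v0.
have vMq q : \sum_l v 0 l * M l q = 0.
  by move/matrixP: vM => /(_ 0 q); rewrite !mxE.
exists (v 0); split.
- apply/existsP; apply: contraNT v0 => /existsPn h.
  by apply/eqP/rowP => l; rewrite mxE; apply/eqP; move: (h l); rewrite negbK.
- move=> l kl; have lk : (l - k.+1 < n - k.+1)%N by have := ltn_ord l; lia.
  rewrite -(vMq (rshift p (Ordinal lk))) (bigD1 l) //= mxE.
  rewrite -[rshift _ _]/(unsplit (inr _)) unsplitK /= subnK// eqxx mulr1.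
  rewrite big1 ?addr0// => j jl; rewrite mxE.
  rewrite -[rshift _ _]/(unsplit (inr _)) unsplitK /= subnK//.
  by rewrite (negPf (jl : (_ != _ :> nat))) mulr0.
move=> q; rewrite -[RHS](vMq (lshift _ q)).
under eq_bigr do rewrite mulr_sumr.
rewrite exchange_big /=; apply: eq_bigr => l _.
rewrite mxE -[lshift _ _]/(unsplit (inl _)) unsplitK mulr_sumr.
by apply: eq_bigr => i _; rewrite mulrCA.
Qed.

(** The upper half of the Courant-Fischer principle: the span of the first
    [k.+1] eigenvectors, on which the form is at least [lam k] times the squared
    norm, meets every subspace of codimension [p <= k]. *)
Lemma min_max_le p (k : 'I_n) (W : 'I_p -> 'I_n -> C) (mu : C) :
  (forall i j : 'I_n, (i <= j)%N -> lam j <= lam i) ->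
  (p <= k)%N ->
  (forall y, (forall q, \sum_i W q i * y i = 0) ->
     \sum_i \sum_j y i * (y j)^* * B i j <= mu * \sum_i `|y i| ^+ 2) ->
  lam k <= mu.
Proof.
move=> lam_mono pk form_le.
have [c [[l cl] ck Wc]] := vector_in_span_with_constraints W pk.
have := form_le _ Wc; rewrite orthonormal_form orthonormal_isometry => le.
have c_gt0 : 0 < \sum_l `|c l| ^+ 2.
  rewrite (bigD1 l) //= ltr_wpDr ?exprn_gt0 ?normr_gt0//.
  by apply: sumr_ge0 => i _; rewrite exprn_ge0.
rewrite -(ler_pM2r c_gt0); apply: le_trans le.
rewrite mulr_sumr; apply: ler_sum => i _.
have [ik|ki] := leqP i k; first by rewrite ler_wpM2r ?exprn_ge0// lam_mono.
by rewrite ck// normr0 expr0n !mulr0.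
Qed.

End Orthonormal.

Section RealSpectrum.
Variables (R : rcfType) (n : nat) (B : 'I_n -> 'I_n -> R).
Local Notation C := (complex R).
Local Notation toC x := (real_complex R x : C).
Hypothesis B_sym : forall i j, B i j = B j i.
Hypothesis B_psd : forall g : 'I_n -> R, 0 <= \sum_i \sum_j g i * g j * B i j.

(** The cross terms between real and imaginary parts cancel by symmetry. *)
Lemma complex_form (y : 'I_n -> C) :
  \sum_i \sum_j y i * (y j)^* * toC (B i j) =
  toC (\sum_i \sum_j complex.Re (y i) * complex.Re (y j) * B i j +
   \sum_i \sum_j complex.Im (y i) * complex.Im (y j) * B i j).
Proof.
pose anti i j := (complex.Im (y i) * complex.Re (y j) -
  complex.Re (y i) * complex.Im (y j)) * B i j.
have E i j : y i * (y j)^* * toC (B i j) =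
    toC (complex.Re (y i) * complex.Re (y j) * B i j +
         complex.Im (y i) * complex.Im (y j) * B i j) + toC (anti i j) * 'i%C.
  rewrite /anti; case: (y i) => a b; case: (y j) => c d.
  by apply/eqP; rewrite eq_complex /=; apply/andP; split; apply/eqP; ring.
under eq_bigr do under eq_bigr do rewrite E.
under eq_bigr do rewrite big_split -mulr_suml -!rmorph_sum big_split /=.
rewrite big_split -mulr_suml -!rmorph_sum big_split /=.
suff -> : \sum_i \sum_j anti i j = 0 by rewrite rmorph0 mul0r addr0.
apply/eqP; suff : (\sum_i \sum_j anti i j) *+ 2 == 0 by rewrite mulrn_eq0.
rewrite mulr2n [X in _ + X]exchange_big -big_split /=.
apply/eqP; rewrite big1// => i _; rewrite -big_split big1// => j _.
by rewrite /anti (B_sym j i) /=; ring.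
Qed.

(** The interface of the spectral theory used below: the eigenvectors are
    complex, but they do not appear in the conclusions. *)
Theorem real_spectrum : exists lam : 'I_n -> R,
  [/\ forall k, 0 <= lam k,
      forall i j : 'I_n, (i <= j)%N -> lam j <= lam i,
      \sum_k lam k = \sum_i B i i,
      permanent B <= \sum_(a : {ffun 'I_n -> 'I_n.+1} | (\sum_k a k == n)%N)
        \prod_k (lam k ^+ a k * ((a k)`!%:R / (a k)%:R ^+ a k)) &
      forall p (k : 'I_n) (W : 'I_p -> 'I_n -> R) (mu : R), (p <= k)%N ->
        (forall g : 'I_n -> R, (forall q, \sum_i W q i * g i = 0) ->
          \sum_i \sum_j g i * g j * B i j <= mu * \sum_i g i ^+ 2) ->
        lam k <= mu].
Proof.
pose A : 'M[C]_n := \matrix_(i, j) toC (B i j).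
have A_herm : A \is hermsymmx.
  apply/is_hermitianmxP; rewrite expr0 scale1r; apply/matrixP => i j.
  by rewrite !mxE B_sym; apply/esym/CrealP/complex_realP; exists (B j i).
have := hermitian_normalmx A_herm => /orthomx_spectralP.
have := hermitian_spectral_diag_real A_herm.
have := spectral_unitarymx A.
set P := spectralmx A; set D := spectral_diag A => P_unitary D_real.
rewrite invmx_unitary// => AE.
have [s s_mono] := nonincreasing_perm (fun k => complex.Re (D 0 k)).
pose lam k := complex.Re (D 0 (s k)); exists lam.
pose U k i := P (s k) i.
have lamE k : toC (lam k) = D 0 (s k).
  by rewrite /lam RRe_real//; move/mxOverP: D_real => /(_ 0 (s k)).
have U_orth k l : \sum_i U k i * (U l i)^* = (k == l)%:R.
  move/unitarymxP: P_unitary => /matrixP/(_ (s k) (s l)).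
  rewrite !mxE (inj_eq perm_inj) => <-; apply: eq_bigr => i _.
  by rewrite !mxE.
have BE i j : toC (B i j) = \sum_k toC (lam k) * (U k i)^* * U k j.
  move/matrixP: AE => /(_ i j); rewrite mxE => ->.
  rewrite mxE (reindex_perm s) /=; apply: eq_bigr => k _.
  by rewrite mul_mx_diag !mxE lamE [X in X * _]mulrC.
have lam_mono (i j : 'I_n) : (i <= j)%N -> lam j <= lam i by exact: s_mono.
have lam_ge0 k : 0 <= lam k.
  pose c l : C := (l == k)%:R.
  have cE : \sum_l toC (lam l) * `|c l| ^+ 2 = toC (lam k).
    rewrite (bigD1 k) //= big1 ?addr0 => [|l lk].
      by rewrite /c eqxx normr1 expr1n mulr1.
    by rewrite /c (negPf lk) normr0 expr0n mulr0.
  have := orthonormal_form (fun l => toC (lam l)) U_orth c.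
  cbv zeta; under eq_bigr do under eq_bigr do rewrite -BE.
  rewrite (complex_form (fun i => \sum_k c k * U k i)) cE => /complexI <-.
  exact: addr_ge0.
split=> //.
- apply: (@complexI R); rewrite !rmorph_sum /=.
  under [RHS]eq_bigr do rewrite BE.
  rewrite exchange_big /=; apply: eq_bigr => k _.
  under [RHS]eq_bigr do rewrite -mulrA [X in _ * X]mulrC.
  by rewrite -mulr_sumr U_orth eqxx mulr1.
- rewrite -lecR.
  have -> : toC (permanent B) =
      permanent (fun i j => \sum_k toC (lam k) * (U k i)^* * U k j).
    rewrite /permanent rmorph_sum; apply: eq_bigr => t _.
    by rewrite rmorph_prod; apply: eq_bigr => i _; rewrite -BE.
  apply: (le_trans (permanent_le (orthonormal_isometry U_orth) _)).
    by move=> k; rewrite ler0c.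
  rewrite rmorph_sum; apply: ler_sum => a _; rewrite rmorph_prod.
  rewrite le_eqVlt; apply/orP; left; apply/eqP; apply: eq_bigr => k _.
  by rewrite rmorphM fmorph_div !rmorphXn /= !rmorph_nat.
move=> p k W mu pk form_le; rewrite -lecR.
apply: (@min_max_le _ _ U (fun k => toC (lam k)) U_orth p k
  (fun q i => toC (W q i)) (toC mu)) => //.
  by move=> i j ij; rewrite lecR lam_mono.
move=> y Wy.
have Wre q : \sum_i W q i * complex.Re (y i) = 0.
  have := Wy q => /(congr1 (@complex.Re R)).
  rewrite (raddf_sum (@complex.Re R : {additive Rcomplex R -> R})) => E.
  by apply: etrans E; apply: eq_bigr => i _; case: (y i) => a b /=; rewrite mul0r subr0.
have Wim q : \sum_i W q i * complex.Im (y i) = 0.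
  have := Wy q => /(congr1 (@complex.Im R)).
  rewrite (raddf_sum (@complex.Im R : {additive Rcomplex R -> R})) => E.
  by apply: etrans E; apply: eq_bigr => i _; case: (y i) => a b /=; rewrite mul0r addr0.
under eq_bigr do under eq_bigr do rewrite -BE.
rewrite complex_form.
have -> : \sum_i `|y i| ^+ 2 =
    toC (\sum_i complex.Re (y i) ^+ 2 + \sum_i complex.Im (y i) ^+ 2).
  rewrite -big_split /= rmorph_sum /=. apply: eq_bigr => i _.
  by rewrite -add_Re2_Im2.
by rewrite -rmorphM lecR mulrDr lerD// form_le.
Qed.
End RealSpectrum.

(** * From the symmetric sum to a product over eigenvalues *)

Section Weights.
Variable R : realType.
Implicit Types (a n N : nat) (x : R).
Local Notation e := (expR 1 : R).

Lemma expR1_le4 : e <= 4.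
Proof.
have h : 1/2 <= expR (- (1/2)) :> R by have := expR_ge1Dx (- (1/2) : R); lra.
have -> : e = (expR (- (1/2)))^-1 ^+ 2.
  by rewrite -expRN -expRM_natl; congr expR; lra.
have -> : 4 = (1/2)^-1 ^+ 2 :> R by lra.
by rewrite lerXn2r ?nnegrE ?invr_ge0 ?expR_ge0// lef_pV2 ?posrE ?expR_gt0//; lra.
Qed.

Lemma expR1_ge1 : 1 <= e.
Proof. by have := expR_ge1Dx (1 : R); lra. Qed.

(** The largest term of the exponential series at [a], equal to [expR a] up to
    a factor polynomial in [a]. *)
Definition peak a : R := a%:R ^+ a / a`!%:R.

Lemma peak_gt0 a : 0 < peak a.
Proof.
rewrite divr_gt0 ?ltr0n ?fact_gt0//.
by case: a => [|a]; rewrite ?expr0// exprn_gt0.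
Qed.

Lemma peakS a : peak a.+1 = a.+1%:R ^+ a / a`!%:R.
Proof.
rewrite /peak factS natrM exprS -mulf_div divff ?mul1r ?pnatr_eq0//.
Qed.

Lemma peakS_le a : peak a.+1 <= e * peak a.
Proof.
rewrite peakS mulrA; apply: ler_wpM2r; first by rewrite invr_ge0.
case: a => [|a]; first by rewrite !expr0 mulr1 expR1_ge1.
have -> : e = expR (a.+1%:R^-1) ^+ a.+1.
  by rewrite -expRM_natl divff ?pnatr_eq0.
rewrite -exprMn lerXn2r ?nnegrE ?mulr_ge0 ?expR_ge0//.
rewrite -ler_pdivrMr ?ltr0n//; apply: le_trans (expR_ge1Dx _).
by rewrite -[in leLHS]natr1 mulrDl divff ?pnatr_eq0// mul1r.
Qed.

Lemma peakD_le a b : peak (a + b) <= e ^+ b * peak a.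
Proof.
elim: b => [|b IHb]; first by rewrite addn0 mul1r.
rewrite addnS exprS -mulrA; apply: (le_trans (peakS_le _)).
by rewrite ler_pM2l ?expR_gt0.
Qed.

(** An upper bound for [expR a / peak a] which is exact at [a = 0], so that
    small eigenvalues contribute factors close to 1. *)
Definition weight a : R := if a == 0%N then 1 else e * a%:R.

Lemma weight_ge0 a : 0 <= weight a.
Proof.
by rewrite /weight; case: ifP => _; rewrite ?ler01 ?mulr_ge0 ?expR_ge0 ?ler0n.
Qed.

Lemma expR1_powS_le a : e * a%:R ^+ a.+1 <= a.+1%:R ^+ a.+1.
Proof.
have -> : a%:R = a.+1%:R * (1 - a.+1%:R^-1) :> R.
  by rewrite mulrBr mulr1 divff ?pnatr_eq0// -natr1 addrK.
rewrite exprMn mulrCA ler_piMr ?exprn_ge0//.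
rewrite -ler_pdivlMl ?expR_gt0// mulr1 -expRN.
have -> : expR (-1) = expR (- (a.+1%:R^-1)) ^+ a.+1 :> R.
  by rewrite -expRM_natl mulrN divff ?pnatr_eq0.
rewrite lerXn2r ?nnegrE ?expR_ge0//; last exact: expR_ge1Dx.
by rewrite subr_ge0 invf_le1 ?ler1n ?ltr0n.
Qed.

Lemma exp_le_weight_peak a : e ^+ a <= weight a * peak a.
Proof.
rewrite /weight; case: a => [|a] /=; first by rewrite /peak fact0 !expr0 divr1 mulr1.
elim: a => [|a IHa]; first by rewrite /peak !expr1 mulr1 divr1 mulr1.
rewrite exprS; apply: (@le_trans _ _ (e * (e * a.+1%:R * peak a.+1))).
  by rewrite ler_pM2l ?expR_gt0.
rewrite -[in leRHS]mulrA ler_pM2l ?expR_gt0// (peakS a.+1) /peak !mulrA.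
rewrite ler_wpM2r ?invr_ge0// -mulrA -!exprS.
exact: expR1_powS_le.
Qed.

(** Raising the argument of [peak] from [a ord0] to [n] costs at most a factor
    [e] for each unit; as the difference is the sum of the other [a k], there is
    a factor [e ^+ a k] to compare with each other [peak (a k)]. *)
Lemma peak_ratio_le m (a : 'I_m.+1 -> nat) n : (\sum_k a k = n)%N ->
  peak n * \prod_k (peak (a k))^-1 <= \prod_(i < m) weight (a (lift ord0 i)).
Proof.
move=> <-; rewrite !big_ord_recl mulrA.
apply: (@le_trans _ _
    (\prod_(i < m) (e ^+ a (lift ord0 i) / peak (a (lift ord0 i))))).
  rewrite big_split /= -expr_sum; apply: ler_wpM2r.
    by apply: prodr_ge0 => i _; rewrite invr_ge0 ltW ?peak_gt0.
  by rewrite ler_pdivrMr ?peak_gt0 ?peakD_le.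
apply: ler_prod => i _; rewrite divr_ge0 ?exprn_ge0 ?expR_ge0 ?(ltW (peak_gt0 _))//=.
by rewrite ler_pdivrMr ?peak_gt0 ?exp_le_weight_peak.
Qed.

Definition spectral_factor N x : R := \sum_(j < N.+1) x ^+ j * weight j.

(** The exponent at index 0 is determined by the others, and the power of
    [lam ord0] is at most 1, so the sum embeds into a product over the other
    indices. *)
Lemma weighted_sum_le m (lam : 'I_m.+1 -> R) :
  (forall k, 0 <= lam k) -> lam ord0 <= 1 ->
  m.+1%:R ^+ m.+1 / m.+1`!%:R *
    \sum_(a : {ffun 'I_m.+1 -> 'I_m.+2} | (\sum_k a k == m.+1)%N)
        \prod_k (lam k ^+ a k * ((a k)`!%:R / (a k)%:R ^+ a k))
  <= \prod_(i < m) spectral_factor m.+1 (lam (lift ord0 i)).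
Proof.
move=> lam0 lam1; rewrite mulr_sumr.
pose rest (a : {ffun 'I_m.+1 -> 'I_m.+2}) : {ffun 'I_m -> 'I_m.+2} :=
  [ffun i => a (lift ord0 i)].
pose w (g : {ffun 'I_m -> 'I_m.+2}) : R :=
  \prod_i (lam (lift ord0 i) ^+ g i * weight (g i)).
have w0 g : 0 <= w g.
  by apply: prodr_ge0 => i _; rewrite mulr_ge0 ?exprn_ge0 ?weight_ge0.
apply: (@le_trans _ _
    (\sum_(a : {ffun 'I_m.+1 -> 'I_m.+2} | (\sum_k a k == m.+1)%N)
    w (rest a))).
  apply: ler_sum => a /eqP aN; rewrite big_split /= mulrCA.
  rewrite (_ : \prod_k (_ / _) = \prod_k (peak (a k))^-1); last first.
    by apply: eq_bigr => k _; rewrite /peak invf_div.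
  rewrite /w big_split /=; apply: ler_pM.
  - by apply: prodr_ge0 => k _; rewrite exprn_ge0.
  - rewrite mulr_ge0 ?(ltW (peak_gt0 _))//.
    by apply: prodr_ge0 => k _; rewrite invr_ge0 ltW ?peak_gt0.
  - rewrite big_ord_recl; under [leRHS]eq_bigr do rewrite ffunE.
    rewrite ler_piMl ?exprn_ile1//.
    by apply: prodr_ge0 => k _; rewrite exprn_ge0.
  - under [leRHS]eq_bigr do rewrite ffunE.
    exact: (peak_ratio_le aN).
rewrite /spectral_factor (bigA_distr_bigA (fun i (j : 'I_m.+2) =>
  lam (lift ord0 i) ^+ j * weight j)).
rewrite -(big_imset w (h := rest)) /=; last first.
  move=> a b /eqP aN /eqP bN rab; apply/ffunP => k.
  have ab i : a (lift ord0 i) = b (lift ord0 i).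
    by have := congr1 (fun g : {ffun 'I_m -> 'I_m.+2} => g i) rab; rewrite !ffunE.
  case: (unliftP ord0 k) => [i ->|->]; first exact: ab.
  apply/val_inj => /=; have := etrans aN (esym bN); rewrite !big_ord_recl.
  by rewrite (eq_bigr _ (fun i _ => congr1 val (ab i))); move/addIn.
set A := (X in \sum_(i in X) _); rewrite [leRHS](bigID (mem A)) /=.
by rewrite lerDl sumr_ge0// => g _; exact: w0.
Qed.

(** The closed form makes the bound by [x] visible when [0 <= x <= 1]. *)
Lemma geometric_moment N x :
  (1 - x) ^+ 2 * (\sum_(j < N.+1) j%:R * x ^+ j) =
  x - N.+1%:R * x ^+ N.+1 + N%:R * x ^+ N.+2.
Proof.
elim: N => [|N IHN]; first by rewrite big_ord_recr big_ord0 /=; ring.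
by rewrite big_ord_recr /= mulrDr IHN !exprS -!natr1; ring.
Qed.

Lemma spectral_factorE N x :
  spectral_factor N x = 1 + e * \sum_(j < N.+1) j%:R * x ^+ j.
Proof.
rewrite /spectral_factor !big_ord_recl /= expr0 mul1r mul0r add0r mulr_sumr.
by congr (_ + _); apply: eq_bigr => j _; rewrite /weight /=; ring.
Qed.

Lemma spectral_factor_ge1 N x : 0 <= x -> 1 <= spectral_factor N x.
Proof.
move=> x0; rewrite spectral_factorE lerDl mulr_ge0 ?expR_ge0// sumr_ge0// => j _.
by rewrite mulr_ge0 ?exprn_ge0.
Qed.

Lemma geometric_moment_le N x : 0 <= x <= 1 ->
  (1 - x) ^+ 2 * (\sum_(j < N.+1) j%:R * x ^+ j) <= x.
Proof.
move=> /andP[x0 x1]; rewrite geometric_moment -addrA gerDl.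
rewrite addrC subr_le0 exprS mulrA ler_wpM2r ?exprn_ge0//.
by rewrite -natr1; have : 0 <= N%:R :> R by []; nra.
Qed.

Lemma ln_spectral_factor_size N x : (0 < N)%N -> 0 <= x <= 1 ->
  ln (spectral_factor N x) <= 4 + 2 * ln N%:R.
Proof.
move=> N0 /andP[x0 x1]; have NR : 1 <= N%:R :> R by rewrite ler1n.
have N0R : 0 < N%:R :> R by rewrite ltr0n.
have f1 := spectral_factor_ge1 N x0.
have -> : 4 + 2 * ln N%:R = ln (expR 4 * N%:R ^+ 2) :> R.
  by rewrite lnM ?posrE ?expR_gt0 ?exprn_gt0// expRK lnXn// mulr_natl.
rewrite ler_ln ?posrE ?mulr_gt0 ?expR_gt0 ?exprn_gt0//; last by lra.
rewrite spectral_factorE.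
have S : \sum_(j < N.+1) j%:R * x ^+ j <= N%:R ^+ 2.
  rewrite big_ord_recl mul0r add0r.
  apply: (@le_trans _ _ (\sum_(j < N) N%:R)).
    apply: ler_sum => j _; rewrite -[leRHS]mulr1.
    apply: ler_pM; rewrite ?ler0n ?exprn_ge0 ?exprn_ile1//.
    by rewrite ler_nat lift0.
  by rewrite sumr_const card_ord expr2 mulr_natr.
have S0 : 0 <= \sum_(j < N.+1) j%:R * x ^+ j.
  by apply: sumr_ge0 => j _; rewrite mulr_ge0 ?exprn_ge0.
have := expR1_le4; have := expR_ge1Dx (4 : R); have e0 := expR1_ge1.
set s := \sum_(j < N.+1) _ in S S0 *; set E4 := expR 4.
(* the series is at most 1 + 4 N^2 <= 5 N^2, and 5 <= expR 4 *)
have : 1 <= N%:R ^+ 2 :> R by nra.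
by nra.
Qed.

Lemma ln_spectral_factor_gap N x d : 0 <= x -> x <= 1 - expR (- d) ->
  ln (spectral_factor N x) <= 4 + 2 * d.
Proof.
move=> x0 xd; have d0 := expR_gt0 (- d); have f1 := spectral_factor_ge1 N x0.
have -> : 4 + 2 * d = ln (expR (4 + 2 * d)) by rewrite expRK.
rewrite ler_ln ?posrE ?expR_gt0//; last by lra.
rewrite expRD (_ : expR (2 * d) = (expR (- d) ^+ 2)^-1); last first.
  by rewrite -expRM_natl -expRN; congr expR; ring.
rewrite ler_pdivlMr ?exprn_gt0//.
apply: (@le_trans _ _ (spectral_factor N x * (1 - x) ^+ 2)).
  rewrite ler_wpM2l ?(le_trans _ f1)// lerXn2r ?nnegrE//; lra.
have := @geometric_moment_le N x; rewrite x0 /= => /(_ ltac:(lra)).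
rewrite spectral_factorE; set s := \sum_(j < N.+1) _ => S.
have := expR1_le4; have := expR_ge1Dx (4 : R); have e0 := expR1_ge1.
by nra.
Qed.

Lemma ln_spectral_factor_small N x : 0 <= x <= 1 / 2 ->
  ln (spectral_factor N x) <= 16 * x.
Proof.
move=> /andP[x0 x1]; have f1 := spectral_factor_ge1 N x0.
have -> : 16 * x = ln (expR (16 * x)) by rewrite expRK.
rewrite ler_ln ?posrE ?expR_gt0//; last by lra.
apply: (le_trans _ (expR_ge1Dx _)); rewrite spectral_factorE lerD2l.
have := @geometric_moment_le N x; rewrite x0 /= => /(_ ltac:(lra)).
set s := \sum_(j < N.+1) _ => S.
have S0 : 0 <= s by apply: sumr_ge0 => j _; rewrite mulr_ge0 ?exprn_ge0.
have := expR1_le4; have e0 := expR1_ge1.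
(* for x <= 1/2 the moment is at most x / (1 - x)^2 <= 4 x, and e <= 4 *)
have q : 1 / 4 <= (1 - x) ^+ 2 by rewrite expr2; nra.
have s4 : s <= 4 * x by have := ler_wpM2r S0 q; lra.
have := ler_pM (ltW (expR_gt0 (1 : R))) S0 expR1_le4 s4; lra.
Qed.

End Weights.

(** * A permanent bound from spectral gaps *)

Section SpectralSum.
Variable R : realType.

Lemma spectral_factor_mono N (x y : R) : 0 <= x -> x <= y ->
  spectral_factor N x <= spectral_factor N y.
Proof.
move=> x0 xy; apply: ler_sum => j _; rewrite ler_wpM2r ?weight_ge0//.
by rewrite lerXn2r// nnegrE (le_trans x0).
Qed.

(** Every index below [K + K] is charged to its residue modulo [K], so each
    residue is charged at most twice. *)
Lemma sum_periodic_le m K (f : nat -> R) : (forall i, 0 <= f i) ->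
  \sum_(i < m) (if (i < K + K)%N then f (i %% K)%N else 0) <=
  2 * \sum_(i < K) f i.
Proof.
move=> f0; rewrite -big_mkcond /=.
apply: (@le_trans _ _ (\sum_(i < m + (K + K) | (i < K + K)%N) f (i %% K)%N)).
  by rewrite [leRHS]big_split_ord /= lerDl sumr_ge0.
rewrite -(big_ord_widen _ (fun i => f (i %% K)%N)) ?leq_addl//.
rewrite big_split_ord /= mulr_natl mulr2n.
under eq_bigr => i _ do rewrite modn_small//.
by under [X in _ + X <= _]eq_bigr => i _ do rewrite modnDl modn_small//.
Qed.

(** By the bound on the sum, [lam (lift ord0 i)] exceeds 1/2 only if
    [i < 2 * K]; then [i] is charged to [k = i %% K + 1 <= i + 1], whose eigenvalue
    is at least as large. *)
Lemma sum_ln_spectral_factor_le m N K (c : R) (lam : 'I_m.+1 -> R) (X : nat -> R) :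
  (forall k, 0 <= lam k) -> (forall i j : 'I_m.+1, (i <= j)%N -> lam j <= lam i) ->
  \sum_k lam k <= c + 1 -> c < K%:R -> K%:R <= c + 1 ->
  (forall k, 0 <= X k) ->
  (forall k : 'I_m.+1, (0 < k <= K)%N ->
    ln (spectral_factor N (lam k)) <= 8 + 2 * X k) ->
  \sum_(i < m) ln (spectral_factor N (lam (lift ord0 i))) <=
    32 * (c + 1) + 4 * \sum_(1 <= k < K.+1) X k.
Proof.
move=> lam0 lam_mono lam_sum cK Kc X0 lamX.
pose G i : R := 8 + 2 * X i.+1.
have G0 i : 0 <= G i by rewrite /G; have := X0 i.+1; lra.
have c0 : 0 <= c + 1 by apply: le_trans lam_sum; exact: sumr_ge0.
apply: (@le_trans _ _ (\sum_(i < m)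
   (16 * lam (lift ord0 i) + if (i < K + K)%N then G (i %% K)%N else 0))).
  apply: ler_sum => i _; have l0 := lam0 (lift ord0 i).
  have [small|large] := leP (lam (lift ord0 i)) (1 / 2).
    apply: (@le_trans _ _ (16 * lam (lift ord0 i))).
      by apply: ln_spectral_factor_small; rewrite l0.
    by rewrite lerDl; case: ifP.
  (* the i.+2 largest eigenvalues exceed 1/2 *)
  have iK : (i < K + K)%N.
    have : \sum_(j < m.+1 | (j < i.+2)%N) (1 / 2 : R) <= c + 1.
      apply: le_trans lam_sum.
      rewrite [leRHS](bigID (fun j : 'I_m.+1 => (j < i.+2)%N)) /=.
      apply: ler_wpDr; first by rewrite sumr_ge0.
      apply: ler_sum => j ji; apply: (le_trans (ltW large)).
      by apply: lam_mono; rewrite lift0.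
    rewrite -(big_ord_widen _ (fun=> (1 / 2 : R))); last by rewrite !ltnS ltn_ord.
    rewrite sumr_const card_ord -[leLHS]mulr_natr => h.
    rewrite -(ltr_nat R) natrD; move: h.
    have -> : i.+2%:R = i%:R + 2 :> R by rewrite -natrD addn2.
    lra.
  rewrite iK; apply: ler_wpDl; first by rewrite mulr_ge0.
  have K0 : (0 < K)%N by lia.
  have km : ((i %% K).+1 < m.+1)%N by rewrite ltnS (leq_ltn_trans (leq_mod _ _)).
  apply: (@le_trans _ _ (ln (spectral_factor N (lam (Ordinal km))))).
    rewrite ler_ln ?posrE ?(lt_le_trans ltr01 (spectral_factor_ge1 _ _))//.
    by apply: spectral_factor_mono => //; apply: lam_mono; rewrite lift0 /= ltnS leq_mod.
  by apply: lamX => /=; rewrite ltn_mod.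
rewrite big_split /= -mulr_sumr.
have S1 : \sum_(i < m) lam (lift ord0 i) <= c + 1.
  by apply: le_trans lam_sum; rewrite [leRHS]big_ord_recl lerDr.
have S2 := sum_periodic_le m K G0.
have -> : \sum_(1 <= k < K.+1) X k = \sum_(i < K) X i.+1.
  by rewrite big_add1 big_mkord.
move: S2; rewrite /G big_split /= sumr_const card_ord -mulr_natr -mulr_sumr.
set s := \sum_(i < K) X i.+1; set t := \sum_(i < m) _ in S1 *.
set u := \sum_(i < m) _; lra.
Qed.

(** The two alternatives for [k] are the two arguments of the minimum in the
    theorem: the eigenvalue of index [k] is only known to be at most 1, or it is
    kept away from 1 by [k] linear constraints. *)
Theorem permanent_exp_le m (B : 'I_m.+1 -> 'I_m.+1 -> R) K (c : R) (X : nat -> R)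
    (form := fun g : 'I_m.+1 -> R => \sum_i \sum_j g i * g j * B i j) :
  (forall i j, B i j = B j i) ->
  (forall g, 0 <= form g <= \sum_i g i ^+ 2) ->
  \sum_i B i i <= c + 1 -> c < K%:R -> K%:R <= c + 1 ->
  (forall k, 0 <= X k) ->
  (forall k : 'I_m.+1, (0 < k <= K)%N -> ln m.+1%:R <= X k \/
    exists W : 'I_k -> 'I_m.+1 -> R, forall g,
      (forall q, \sum_i W q i * g i = 0) ->
      form g <= (1 - expR (- (X k + 2))) * \sum_i g i ^+ 2) ->
  m.+1%:R ^+ m.+1 / m.+1`!%:R * permanent B <=
    expR (32 * (c + 1) + 4 * \sum_(1 <= k < K.+1) X k).
Proof.
move=> B_sym B_form B_tr cK Kc X0 gap.
have B_psd g : 0 <= form g by case/andP: (B_form g).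
have [lam [lam0 lam_mono lam_tr perm_le courant]] := real_spectrum B_sym B_psd.
have lam1 : lam ord0 <= 1.
  apply: (courant 0%N ord0 (fun q i => 0) 1) => // g _.
  by rewrite mul1r; case/andP: (B_form g).
have lam_le1 k : lam k <= 1 by apply: le_trans lam1; exact: lam_mono.
have f_gt0 i : 0 < spectral_factor m.+1 (lam (lift ord0 i)).
  by rewrite (lt_le_trans ltr01)// spectral_factor_ge1.
apply: (@le_trans _ _ (\prod_(i < m) spectral_factor m.+1 (lam (lift ord0 i)))).
  apply: le_trans (weighted_sum_le lam0 lam1).
  by rewrite ler_wpM2l// divr_ge0 ?exprn_ge0.
have -> : \prod_(i < m) spectral_factor m.+1 (lam (lift ord0 i)) =
    expR (\sum_(i < m) ln (spectral_factor m.+1 (lam (lift ord0 i)))).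
  by rewrite expR_sum; apply: eq_bigr => i _; rewrite lnK ?posrE ?f_gt0.
rewrite ler_expR; apply: sum_ln_spectral_factor_le => //; first by rewrite lam_tr.
move=> k kK; have [size|[W Wgap]] := gap k kK.
  have := @ln_spectral_factor_size R m.+1 (lam k) isT; rewrite lam0 lam_le1 => /(_ isT).
  by move/le_trans; apply; lra.
have := courant k k W _ (leqnn _) Wgap => /(ln_spectral_factor_gap m.+1 (lam0 k)).
by move/le_trans; apply; lra.
Qed.

End SpectralSum.

Local Open Scope classical_set_scope.
Local Open Scope ring_scope.
Local Open Scope ereal_scope.

(** * Densities of mixtures and products *)

Section Density.
Context d (T : measurableType d) (R : realType).
Implicit Types (P Q : probability T R) (f : T -> R).

(** Real-valued and everywhere nonnegative representatives, so that densities
    can be multiplied and summed pointwise. *)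
Definition has_density P Q f : Prop := [/\ measurable_fun setT f,
  forall x, (0 <= f x)%R &
  forall A, measurable A -> P A = \int[Q]_(x in A) (f x)%:E].

Lemma has_density_dominates P Q f : has_density P Q f -> P `<< Q.
Proof.
move=> [mf f0 PQ]; apply/null_content_dominatesP => A mA QA0.
by rewrite PQ// null_set_integral//; exact/measurable_EFinP/measurable_funTS.
Qed.

Lemma density_integral P Q f (h : T -> \bar R) : has_density P Q f ->
  measurable_fun setT h -> (forall x, 0 <= h x) ->
  \int[P]_x h x = \int[Q]_x (h x * (f x)%:E).
Proof.
move=> PQf mh h0; have PQ := has_density_dominates PQf; have [mf f0 Pf] := PQf.
rewrite -(Radon_Nikodym_SigmaFinite.change_of_variables PQ)//.
have fi := Radon_Nikodym_SigmaFinite.f_integrable PQ.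
apply: ae_eq_integral => //.
- by apply: emeasurable_funM => //; exact: measurable_int fi.
- by apply: emeasurable_funM => //; exact/measurable_EFinP.
- apply: ae_eqe_mul2l; apply: integral_ae_eq => //; first exact/measurable_EFinP.
  by move=> E _ mE; rewrite -Pf// -Radon_Nikodym_SigmaFinite.f_integral.
Qed.

Lemma density_integral1 P Q f : has_density P Q f -> \int[Q]_x (f x)%:E = 1.
Proof. by move=> [mf f0 <-]//; rewrite probability_setT. Qed.

(** Expanding the square, since densities integrate to 1. *)
Lemma chi2_div_density P Q f : has_density P Q f ->
  1 + chi2_div P Q = \int[Q]_x (f x ^+ 2)%:E.
Proof.
move=> PQf; have PQ := has_density_dominates PQf; have [mf f0 Pf] := PQf.
have mfE : measurable_fun setT (EFin \o f) by exact/measurable_EFinP.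
pose g := Radon_Nikodym (charge_of_finite_measure P) Q.
have gi : Q.-integrable setT g by exact: Radon_Nikodym_integrable.
have mg : measurable_fun setT g by exact: measurable_int gi.
rewrite /chi2_div asboolT//.
have m2 : measurable_fun setT (fun x => ((f x - 1) ^+ 2)%:E).
  by apply/measurable_EFinP/measurable_funX; exact: measurable_funB.
have -> : \int[Q]_x (g x - 1) ^+ 2 = \int[Q]_x ((f x - 1) ^+ 2)%:E.
  apply: ae_eq_integral => //.
  - under eq_fun do rewrite expe2.
    have mB : measurable_fun setT (fun x => g x - 1) by exact: emeasurable_funB.
    exact: emeasurable_funM.
  - have : ae_eq Q setT g (EFin \o f).
      apply: integral_ae_eq => //.
      by move=> E _ mE; rewrite -Radon_Nikodym_integral//; exact: Pf.
    by apply: filterS => x /= + xT => /(_ xT) ->.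
have E : \int[Q]_x ((f x - 1) ^+ 2)%:E + \int[Q]_x (2 * f x)%:E =
    \int[Q]_x (f x ^+ 2)%:E + \int[Q]_x 1.
  have m3 : measurable_fun setT (fun x => (f x ^+ 2)%:E).
    by apply/measurable_EFinP; exact: measurable_funX.
  have m4 : measurable_fun setT (fun x => (2 * f x)%:E).
    by apply/measurable_EFinP; exact: measurable_funM.
  rewrite -!ge0_integralD//.
  - by apply: eq_integral => x _; rewrite -!EFinD; congr _%:E; ring.
  - by move=> x _; rewrite lee_fin exprn_ge0.
  - by move=> x _; rewrite lee_fin exprn_even_ge0.
  - by move=> x _; rewrite lee_fin mulr_ge0.
move: E; under [X in _ + X = _]eq_integral do rewrite EFinM.
rewrite ge0_integralZl// ?lee_fin//; last by move=> x _; rewrite lee_fin.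
rewrite (density_integral1 PQf) integral_cst//= ?probability_setT !mule1 => E.
have one : (1 : \bar R) \is a fin_num by [].
rewrite -[RHS](addeK _ one) -E -[X in _ + X - _]/((2)%:E) -[LHS](addeK _ one).
congr (_ - _).
by rewrite addeAC addeC; congr (_ + _).
Qed.
Lemma uniform_mixtureE m (P : 'I_m.+1 -> probability T R) (A : set T) :
  m.+1%:R%:E * uniform_mixture ord0 P A = \sum_i P i A.
Proof.
rewrite /= /uniform_mixture card_ord muleA -EFinM divff ?pnatr_eq0// mul1e.
by [].
Qed.

(** The sum of the Radon-Nikodym derivatives is [m.+1] almost everywhere; on the
    exceptional null set all of them are replaced by 1.  The pointwise identity
    also makes every density bounded by [m.+1]. *)
Lemma uniform_mixture_densities m (P : 'I_m.+1 -> probability T R) :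
  exists f : 'I_m.+1 -> T -> R,
    (forall i, has_density (P i) (uniform_mixture ord0 P) (f i)) /\
    (forall x, \sum_i f i x = m.+1%:R)%R.
Proof.
pose Q : probability T R := uniform_mixture ord0 P.
have PQ i : P i `<< Q.
  apply/null_content_dominatesP => A mA QA0; apply/eqP.
  have S0 : \sum_j P j A = 0 by rewrite -uniform_mixtureE [X in _ * X]QA0 mule0.
  rewrite eq_le measure_ge0 andbT -S0 (bigD1 i)//= leeDl//.
  by apply: sume_ge0 => j _.
pose g i := Radon_Nikodym_SigmaFinite.f (P i) Q.
have gi i : Q.-integrable setT (g i) := Radon_Nikodym_SigmaFinite.f_integrable (PQ i).
have g0 i x : 0 <= g i x := Radon_Nikodym_SigmaFinite.f_ge0 (PQ i) x.
have gfin i x : g i x \is a fin_num := Radon_Nikodym_SigmaFinite.f_fin_num (PQ i) x.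
have mg i : measurable_fun setT (g i) := measurable_int _ (gi i).
pose r i x := fine (g i x).
have mr i : measurable_fun setT (r i) by exact: measurableT_comp.
have rE i x : (r i x)%:E = g i x by rewrite fineK.
have msum : measurable_fun setT (fun x => \sum_i r i x)%R by exact: measurable_sum.
have sumE : ae_eq Q setT (fun x => (\sum_i r i x)%:E)%R (cst m.+1%:R%:E).
  apply: integral_ae_eq => //.
  - under eq_fun do rewrite -sumEFin; apply: (integrable_sum measurableT) => i _.
    by under eq_fun do rewrite rE.
  - move=> E _ mE; rewrite integral_cst//.
    rewrite [RHS]uniform_mixtureE.
    under eq_integral do rewrite -sumEFin.
    rewrite ge0_integral_sum//.
    + apply: eq_bigr => i _; under eq_integral do rewrite rE.
      by apply/esym; exact: (Radon_Nikodym_SigmaFinite.f_integral (PQ i)).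
    + by move=> i; apply/measurable_funTS/measurable_EFinP.
    + by move=> i x _; rewrite rE.
pose f i x : R := if (\sum_j r j x == m.+1%:R)%R then r i x else 1%R.
have mf i : measurable_fun setT (f i).
  apply: measurable_fun_ifT => //; exact: measurable_fun_eqr.
exists f; split => [i|x]; last first.
  rewrite /f; have [//|_] := eqVneq (\sum_j r j x)%R m.+1%:R.
  by rewrite sumr_const card_ord.
split=> // [x|A mA].
  by rewrite /f; case: ifP => // _; rewrite fine_ge0.
rewrite (Radon_Nikodym_SigmaFinite.f_integral (PQ i))//.
apply: ae_eq_integral => //.
- exact: (measurable_funTS (mg i)).
- exact/measurable_EFinP/measurable_funTS.
- apply: filterS sumE => x /= /(_ I) [xE] _; rewrite /f xE eqxx.
  by rewrite rE.
Qed.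
Lemma integral_uniform_mixture m (P : 'I_m.+1 -> probability T R)
    (h : T -> \bar R) : measurable_fun setT h -> (forall x, 0 <= h x) ->
  m.+1%:R%:E * \int[uniform_mixture ord0 P]_x h x = \sum_i \int[P i]_x h x.
Proof.
move=> mh h0; have [f [Pf fsum]] := uniform_mixture_densities P.
under [RHS]eq_bigr do rewrite (density_integral (Pf _) mh h0).
rewrite -ge0_integral_sum//.
- rewrite -ge0_integralZl ?lee_fin//.
  apply: eq_integral => x _.
  rewrite -ge0_sume_distrr; last by move=> i _; rewrite lee_fin; case: (Pf i).
  by rewrite sumEFin fsum muleC.
- move=> i; apply: emeasurable_funM => //; apply/measurable_EFinP.
  by case: (Pf i).
- by move=> i x _; rewrite mule_ge0// lee_fin; case: (Pf i).
Qed.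

End Density.

Section ProductDensity.
Context d (T : measurableType d) (R : realType).

Lemma integral_product_prob n (P : 'I_n.+1 -> probability T R)
    (h : n.+1.-tuple T -> \bar R) :
  measurable_fun setT h -> (forall t, 0 <= h t) ->
  \int[product_prob P]_t h t =
  \int[P ord0]_x \int[product_prob (fun i => P (lift ord0 i))]_t
     h (tuple_cons (x, t)).
Proof.
move=> mh h0; rewrite ge0_integral_distribution//= fubini_tonelli1//.
by apply: measurableT_comp => //; exact: measurable_tuple_cons.
Qed.

(** By Tonelli and induction, changing measure in one coordinate at a time. *)
Lemma product_density_integral n (P Q : 'I_n -> probability T R)
    (f : 'I_n -> T -> R) (h : n.-tuple T -> \bar R) :
  (forall i, has_density (P i) (Q i) (f i)) ->
  measurable_fun setT h -> (forall t, 0 <= h t) ->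
  \int[product_prob P]_t h t =
  \int[product_prob Q]_t (h t * (\prod_i f i (tnth t i))%:E).
Proof.
elim: n => [|n IHn] in P Q f h *; move=> Pf mh h0.
  by apply: eq_integral => t _; rewrite big_ord0 mule1.
have mf i : measurable_fun setT (f i) by case: (Pf i).
have f0 i x : (0 <= f i x)%R by case: (Pf i).
have mF m (g : 'I_m -> T -> R) : (forall i, measurable_fun setT (g i)) ->
    measurable_fun setT (fun t : m.-tuple T => \prod_i g i (tnth t i))%R.
  move=> mg; apply: measurable_prod => i _.
  by apply: measurableT_comp => //; exact: measurable_tnth.
have mc (k : n.+1.-tuple T -> \bar R) (x : T) : measurable_fun setT k ->
    measurable_fun setT (fun t => k (tuple_cons (x, t))).
  move=> mk; apply: measurableT_comp => //.
  apply: (measurableT_comp (@measurable_tuple_cons _ _ _)).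
  exact: measurable_pair1.
rewrite !integral_product_prob//; last 2 first.
  by apply: emeasurable_funM => //; apply/measurable_EFinP; exact: mF.
  by move=> t; rewrite mule_ge0// lee_fin prodr_ge0.
have inner x : \int[product_prob (fun i => P (lift ord0 i))]_t h (tuple_cons (x, t)) =
  \int[product_prob (fun i => Q (lift ord0 i))]_t (h (tuple_cons (x, t)) *
     (\prod_i f (lift ord0 i) (tnth t i))%:E).
  apply: (IHn _ _ (fun i => f (lift ord0 i)) (fun t => h (tuple_cons (x, t)))) => //.
  exact: mc.
under eq_integral do rewrite inner.
pose k (z : T * n.-tuple T) : \bar R :=
  h (tuple_cons z) * (\prod_i f (lift ord0 i) (tnth z.2 i))%:E.
have mk : measurable_fun setT k.
  apply: emeasurable_funM.
    by apply: measurableT_comp => //; exact: measurable_tuple_cons.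
  apply/measurable_EFinP.
  exact: (measurableT_comp (mF _ _ (fun i => mf (lift ord0 i)))).
have k0 z : 0 <= k z by rewrite mule_ge0// lee_fin prodr_ge0.
rewrite (density_integral (Pf ord0)); last 2 first.
- exact: (measurable_fun_fubini_tonelli_F _ mk k0).
- by move=> x; apply: integral_ge0 => t _; exact: (k0 (x, t)).
apply: eq_integral => x _.
rewrite -ge0_integralZr//; last 3 first.
- by apply: (measurableT_comp mk); exact: measurable_pair1.
- by move=> t _; exact: (k0 (x, t)).
- by rewrite lee_fin.
apply: eq_integral => t _; rewrite -muleA -EFinM; congr (_ * _%:E).
rewrite big_ord_recl mulrC; congr (_ * _)%R.
by apply: eq_bigr => i _; rewrite tnthS.
Qed.

Lemma product_density n (P Q : 'I_n -> probability T R) (f : 'I_n -> T -> R) :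
  (forall i, has_density (P i) (Q i) (f i)) ->
  has_density (product_prob P) (product_prob Q)
    (fun t => \prod_i f i (tnth t i))%R.
Proof.
move=> Pf; split.
- apply: measurable_prod => i _; apply: measurableT_comp; last exact: measurable_tnth.
  by case: (Pf i).
- by move=> t; apply: prodr_ge0 => i _; case: (Pf i).
- move=> A mA; rewrite -[A in LHS]setIT -integral_indic//.
  rewrite (product_density_integral Pf); last 2 first.
  + exact/measurable_EFinP.
  + by move=> t; rewrite lee_fin.
  rewrite [RHS]integral_mkcond epatch_indic.
  by apply: eq_integral => t _; rewrite muleC.
Qed.

Lemma product_integral n (Q : 'I_n -> probability T R) (g : 'I_n -> T -> R) :
  (forall i, measurable_fun setT (g i)) -> (forall i x, 0 <= g i x)%R ->
  \int[product_prob Q]_t (\prod_i g i (tnth t i))%:E =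
  \prod_i \int[Q i]_x (g i x)%:E.
Proof.
elim: n => [|n IHn] in Q g *; move=> mg g0.
  under eq_integral do rewrite big_ord0.
  by rewrite big_ord0 integral_cst//= probability_setT mule1.
have mG m (f : 'I_m -> T -> R) : (forall i, measurable_fun setT (f i)) ->
    measurable_fun setT (fun t : m.-tuple T => \prod_i f i (tnth t i))%R.
  move=> mf; apply: measurable_prod => i _.
  by apply: measurableT_comp => //; exact: measurable_tnth.
rewrite integral_product_prob; last 2 first.
- by apply/measurable_EFinP; exact: mG.
- by move=> t; rewrite lee_fin prodr_ge0.
rewrite big_ord_recl -IHn// -ge0_integralZr//; last 3 first.
- exact/measurable_EFinP.
- by move=> x _; rewrite lee_fin.
- by apply: integral_ge0 => t _; rewrite lee_fin prodr_ge0.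
apply: eq_integral => x _; rewrite -ge0_integralZl//; last 3 first.
- by apply/measurable_EFinP; exact: (mG _ (fun i => g (lift ord0 i))).
- by move=> t _; rewrite lee_fin prodr_ge0.
- by rewrite lee_fin.
apply: eq_integral => t _; rewrite big_ord_recl EFinM; congr (_ * _%:E).
by apply: eq_bigr => i _; rewrite tnthS.
Qed.

End ProductDensity.

(** * The chi-square divergence of a permutation mixture *)

Section MixtureDensity.
Context d (T : measurableType d) (R : realType).

Lemma mixture_density (I : finType) (i0 : I) (P : I -> probability T R)
    (Q : probability T R) (f : I -> T -> R) :
  (forall i, has_density (P i) Q (f i)) ->
  has_density (uniform_mixture i0 P) Q (fun x => #|I|%:R^-1 * \sum_i f i x)%R.
Proof.
move=> Pf; have mf i : measurable_fun setT (f i) by case: (Pf i).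
have f0 i x : (0 <= f i x)%R by case: (Pf i).
split.
- by apply: measurable_funM => //; exact: measurable_sum.
- by move=> x; rewrite mulr_ge0 ?invr_ge0 ?ler0n// sumr_ge0.
- move=> A mA; rewrite /= /uniform_mixture.
  under eq_bigr => i _ do rewrite (let: And3 _ _ h := Pf i in h A mA).
  rewrite -ge0_integral_sum//; last 2 first.
  + by move=> i; apply/measurable_EFinP/measurable_funTS.
  + by move=> i x _; rewrite lee_fin.
  under [X in _ * X]eq_integral do rewrite sumEFin.
  rewrite -ge0_integralZl//.
  + by apply/measurable_EFinP/measurable_funTS; exact: measurable_sum.
  + by move=> x _; rewrite lee_fin sumr_ge0.
Qed.

End MixtureDensity.

Section PermutationMixture.
Context d (T : measurableType d) (R : realType).
Variables (m : nat) (P : 'I_m.+1 -> probability T R) (f : 'I_m.+1 -> T -> R).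
Local Notation Q := (uniform_mixture ord0 P).
Hypothesis Pf : forall i, has_density (P i) Q (f i).
Hypothesis f_sum : forall x, (\sum_i f i x = m.+1%:R)%R.

Let mf i : measurable_fun setT (f i). Proof. by case: (Pf i). Qed.
Let f0 i x : (0 <= f i x)%R. Proof. by case: (Pf i). Qed.

Lemma density_le i x : (f i x <= m.+1%:R)%R.
Proof. by rewrite -(f_sum x) (bigD1 i)//= lerDl sumr_ge0. Qed.

(** The densities are bounded, so that [fine] loses nothing. *)
Definition overlap i j : R := fine (\int[Q]_x (f i x * f j x)%:E).

Lemma overlapE i j : (overlap i j)%:E = \int[Q]_x (f i x * f j x)%:E.
Proof.
rewrite fineK// ge0_fin_numE; last first.
  by apply: integral_ge0 => x _; rewrite lee_fin mulr_ge0.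
apply: (@le_lt_trans _ _ (\int[Q]_x (m.+1%:R * m.+1%:R)%:E)).
  apply: ge0_le_integral => //.
  - by move=> x _; rewrite lee_fin mulr_ge0.
  - by apply/measurable_EFinP; exact: measurable_funM.
  - by move=> x _; rewrite lee_fin ler_pM// density_le.
by rewrite integral_cst//= probability_setT mule1 ltry.
Qed.

(** The second moment of the average over permutations is a double sum over
    permutations, which depends only on their quotient. *)
Lemma chi2_perm_mixture :
  1 + chi2_div (perm_mixture P) (mean_field P) =
  (m.+1`!%:R^-1 * permanent overlap)%:E.
Proof.
have PS (s : 'S_m.+1) : has_density (product_prob (fun i => P (s i)))
    (mean_field P) (fun t => \prod_i f (s i) (tnth t i))%R.
  by apply: (product_density (f := fun i => f (s i))) => i; exact: Pf.
have := mixture_density (1%g : 'S_m.+1) PS.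
move/chi2_div_density => ->.
pose F (s u : 'S_m.+1) (t : m.+1.-tuple T) : R :=
  (\prod_i (f (s i) (tnth t i) * f (u i) (tnth t i)))%R.
have mF s u : measurable_fun setT (F s u).
  apply: measurable_prod => i _; apply: measurable_funM.
    by apply: (measurableT_comp (mf (s i))); exact: measurable_tnth.
  by apply: (measurableT_comp (mf (u i))); exact: measurable_tnth.
have F0 s u t : (0 <= F s u t)%R by apply: prodr_ge0 => i _; rewrite mulr_ge0.
have intF s u : \int[mean_field P]_t (F s u t)%:E =
    (\prod_i overlap (s i) (u i))%:E.
  rewrite /F (product_integral (fun=> Q) (g := fun i x => (f (s i) x * f (u i) x)%R)).
  - by rewrite -prodEFin; apply: eq_bigr => i _; rewrite overlapE.
  - by move=> i; exact: measurable_funM.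
  - by move=> i x; rewrite mulr_ge0.
have mFs s : measurable_fun setT (fun t => \sum_(u : 'S_m.+1) F s u t)%R.
  exact: measurable_sum.
pose c : R := (m.+1`!%:R^-1)%R.
have sq t : ((#|{: 'S_m.+1}|%:R^-1 *
      \sum_(s : 'S_m.+1) \prod_i f (s i) (tnth t i)) ^+ 2)%:E
    = (c ^+ 2)%:E * (\sum_(s : 'S_m.+1) \sum_(u : 'S_m.+1) F s u t)%:E.
  rewrite -EFinM exprMn card_Sn; congr (_ * _)%:E.
  rewrite expr2 mulr_suml; apply: eq_bigr => s _; rewrite mulr_sumr.
  by apply: eq_bigr => u _; rewrite /F big_split.
under eq_integral do rewrite sq.
rewrite ge0_integralZl//; last 3 first.
- by apply/measurable_EFinP; exact: measurable_sum.
- by move=> t _; rewrite lee_fin sumr_ge0// => s _; rewrite sumr_ge0.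
- by rewrite lee_fin exprn_ge0// invr_ge0 ler0n.
under [X in _ * X]eq_integral do rewrite -sumEFin.
rewrite ge0_integral_sum//; last 2 first.
- by move=> s; exact/measurable_EFinP.
- by move=> s t _; rewrite lee_fin sumr_ge0.
have row (s : 'S_m.+1) : \int[mean_field P]_t (\sum_(u : 'S_m.+1) F s u t)%:E =
    (permanent overlap)%:E.
  under eq_integral do rewrite -sumEFin.
  rewrite ge0_integral_sum//; last 2 first.
  - by move=> u; exact/measurable_EFinP.
  - by move=> u t _; rewrite lee_fin.
  under eq_bigr do rewrite intF.
  rewrite sumEFin; congr _%:E; rewrite /permanent.
  rewrite (reindex_inj (mulgI s)) /=; apply: eq_bigr => u _.
  by rewrite [RHS](reindex_perm s); apply: eq_bigr => i _; rewrite permM.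
under eq_bigr do rewrite row.
rewrite sumEFin sumr_const -EFinM; congr _%:E.
rewrite (_ : #|_| = m.+1`!); last first.
  by rewrite -card_Sn; apply: eq_card => s; rewrite !inE.
rewrite -[X in (_ * X)%R]mulr_natr /c; field.
by rewrite pnatr_eq0 -lt0n fact_gt0.
Qed.
End PermutationMixture.

(** * Hellinger affinity and variance *)

Section HellingerVariance.
Context d (T : measurableType d) (R : realType).
Implicit Types P Q : probability T R.

Lemma hellinger2_ge0 P Q : 0 <= hellinger2 P Q.
Proof. by apply: integral_ge0 => x _; rewrite lee_fin sqr_ge0. Qed.

(** [1 - h / 2] is the Hellinger affinity of [P] and [Q]. *)
Lemma renyi_half_le P Q (r : R) : renyi_half P Q <= r%:E ->
  exists2 h : R, hellinger2 P Q = h%:E & (expR (- (r / 2)) <= 1 - h / 2)%R.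
Proof.
rewrite /renyi_half; have := hellinger2_ge0 P Q.
case: (hellinger2 P Q) => [h| |]// h0; last first.
  by rewrite mulyr gtr0_sg ?invr_gt0// mul1e /= mulrNy ltr0_sg ?mulN1e ?leye_eq//=.
rewrite -EFinM -EFinB => le; exists h => //.
have [y0|y0] := leP (1 - h * 2^-1)%R 0%R.
  move: le; rewrite le0_lneNy ?lee_fin//.
  by rewrite mulrNy ltr0_sg ?mulN1e ?leye_eq//=.
move: le; rewrite lne_EFin// -EFinM lee_fin => le.
rewrite -[leRHS]lnK ?posrE// ler_expR; lra.
Qed.

(** With [p] and [q] the roots of [u] and [v], the difference of the first two
    terms is [2 p q |a - b|], and the triangle inequality splits it into
    [2 p q |a - h|] and [2 p q |b - h|], to which [2 x y <= s x^2 + y^2 / s]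
    applies. *)
Lemma hellinger_pointwise (u v a b h s : R) : (0 <= u -> 0 <= v -> 0 < s ->
  `|a - b| * (u + v) <= `|a - b| * (Num.sqrt u - Num.sqrt v) ^+ 2 +
    (s * ((a - h) ^+ 2 * u + (b - h) ^+ 2 * v) + (u + v) / s))%R.
Proof.
move=> u0 v0 s0.
have su := sqr_sqrtr u0; have sv := sqr_sqrtr v0.
set p := Num.sqrt u in su *; set q := Num.sqrt v in sv *.
have p0 : (0 <= p)%R by exact: sqrtr_ge0.
have q0 : (0 <= q)%R by exact: sqrtr_ge0.
rewrite -su -sv.
have tri : (`|a - b| <= `|a - h| + `|b - h|)%R.
  by rewrite [`|b - h|%R]distrC (le_trans _ (ler_normD _ _))// addrA subrK.
have pq : (0 <= 2 * (p * q))%R by rewrite !mulr_ge0.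
have e1 : (2 * (p * q) * `|a - h| <= s * ((a - h) ^+ 2 * p ^+ 2) + q ^+ 2 / s)%R.
  rewrite -(real_normK (num_real (a - h))) -subr_ge0.
  rewrite [X in (0 <= X)%R](_ : _ = (s * (`|a - h| * p) - q) ^+ 2 / s)%R.
    by rewrite divr_ge0 ?sqr_ge0// ltW.
  by field; rewrite gt_eqF.
have e2 : (2 * (p * q) * `|b - h| <= s * ((b - h) ^+ 2 * q ^+ 2) + p ^+ 2 / s)%R.
  rewrite -(real_normK (num_real (b - h))) -subr_ge0.
  rewrite [X in (0 <= X)%R](_ : _ = (s * (`|b - h| * q) - p) ^+ 2 / s)%R.
    by rewrite divr_ge0 ?sqr_ge0// ltW.
  by field; rewrite gt_eqF.
have := ler_wpM2l pq tri; rewrite mulrDr => tri2.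
have -> : (`|a - b| * (p ^+ 2 + q ^+ 2) = `|a - b| * (p - q) ^+ 2 +
   2 * (p * q) * `|a - b|)%R by ring.
rewrite lerD2l; apply: (le_trans tri2); apply: (le_trans (lerD e1 e2)).
by rewrite le_eqVlt; apply/orP; left; apply/eqP; ring.
Qed.

(** The affinity times [|a - b|] is at most the integral of [|a - h| + |b - h|]
    against the geometric mean of the densities, and Cauchy-Schwarz bounds the
    latter by the variances.  Both steps come from integrating the pointwise
    inequality and optimizing [s]. *)
Lemma hellinger_variance P Q (r a b : R) (h : T -> R) :
  measurable_fun setT h -> renyi_half P Q <= r%:E ->
  (expR (- r) * (a - b) ^+ 2)%:E <=
    2%:E * (\int[P]_x ((a - h x) ^+ 2)%:E + \int[Q]_x ((b - h x) ^+ 2)%:E).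
Proof.
move=> mh /renyi_half_le[H HE Hr].
pose mu : {sigma_finite_measure set T -> \bar R} := measure_add P Q.
have muE A : mu A = P A + Q A by exact: measure_addE.
have PQ0 A : mu A = 0 -> P A = 0 /\ Q A = 0.
  rewrite muE => /eqP; rewrite padde_eq0// => /andP[/eqP ? /eqP ?]; by split.
have Pmu : P `<< mu by apply/null_content_dominatesP => A _ /PQ0[].
have Qmu : Q `<< mu by apply/null_content_dominatesP => A _ /PQ0[].
have dens (N : probability T R) : N `<< mu -> exists u : T -> R,
    [/\ measurable_fun setT u, forall x, (0 <= u x)%R,
        forall k : T -> R, measurable_fun setT k -> (forall x, 0 <= k x)%R ->
          \int[N]_x (k x)%:E = \int[mu]_x (k x * u x)%:E &
        ae_eq mu setT
          (fun x => fine (Radon_Nikodym (charge_of_finite_measure N) mu x)) u].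
  move=> Nmu; pose g := Radon_Nikodym_SigmaFinite.f N mu.
  have gfin x : g x \is a fin_num := Radon_Nikodym_SigmaFinite.f_fin_num Nmu x.
  have mg : measurable_fun setT g :=
    measurable_int _ (Radon_Nikodym_SigmaFinite.f_integrable Nmu).
  exists (fun x => fine (g x)); split.
  - exact: measurableT_comp.
  - by move=> x; rewrite fine_ge0// Radon_Nikodym_SigmaFinite.f_ge0.
  - move=> k mk k0; rewrite -(Radon_Nikodym_SigmaFinite.change_of_variables Nmu)//.
    + by apply: eq_integral => x _; rewrite EFinM fineK.
    + exact/measurable_EFinP.
  - have := ae_eq_Radon_Nikodym_SigmaFinite Nmu measurableT.
    by apply: filterS => x /= /(_ I) <-.
have [u [mu_ u0 Pu uE]] := dens P Pmu.
have [v [mv v0 Qv vE]] := dens Q Qmu.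
have intu : \int[mu]_x (u x)%:E = 1.
  have := Pu (fun=> 1%R) (measurable_cst _) (fun=> ler01).
  rewrite integral_cst//= probability_setT mule1 => ->.
  by apply: eq_integral => x _; rewrite mul1r.
have intv : \int[mu]_x (v x)%:E = 1.
  have := Qv (fun=> 1%R) (measurable_cst _) (fun=> ler01).
  rewrite integral_cst//= probability_setT mule1 => ->.
  by apply: eq_integral => x _; rewrite mul1r.
have mroot (w : T -> R) : measurable_fun setT w ->
    measurable_fun setT (fun x => Num.sqrt (w x)).
  move=> mw; apply: measurableT_comp => //; apply: continuous_measurable_fun.
  exact: sqrt_continuous.
have HuvE : H%:E = \int[mu]_x ((Num.sqrt (u x) - Num.sqrt (v x)) ^+ 2)%:E.
  have mRN (N : probability T R) : N `<< mu -> measurable_fun setT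
      (fun x => fine (Radon_Nikodym (charge_of_finite_measure N) mu x)).
    by move=> Nmu; apply: measurableT_comp => //.
  have msq (w1 w2 : T -> R) : measurable_fun setT w1 -> measurable_fun setT w2 ->
      measurable_fun setT (fun x => ((Num.sqrt (w1 x) - Num.sqrt (w2 x)) ^+ 2)%:E).
    move=> m1 m2; apply/measurable_EFinP/measurable_funX/measurable_funB; exact: mroot.
  rewrite -HE /hellinger2; apply: ae_eq_integral => //.
  - by apply: msq; exact: mRN.
  - exact: msq.
  - by apply: filterS2 uE vE => x /= /(_ I) -> /(_ I) ->.
pose D := \int[P]_x ((a - h x) ^+ 2)%:E + \int[Q]_x ((b - h x) ^+ 2)%:E.
have D0 : 0 <= D by apply: adde_ge0; apply: integral_ge0 => x _; rewrite lee_fin sqr_ge0.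
have ID (w1 w2 : T -> R) : measurable_fun setT w1 -> measurable_fun setT w2 ->
    (forall x, 0 <= w1 x)%R -> (forall x, 0 <= w2 x)%R ->
    \int[mu]_x (w1 x + w2 x)%:E = \int[mu]_x (w1 x)%:E + \int[mu]_x (w2 x)%:E.
  move=> m1 m2 w10 w20; rewrite -ge0_integralD//.
  - by move=> x _; rewrite lee_fin.
  - exact/measurable_EFinP.
  - by move=> x _; rewrite lee_fin.
  - exact/measurable_EFinP.
have IZ (c : R) (w : T -> R) : (0 <= c)%R -> measurable_fun setT w ->
    (forall x, 0 <= w x)%R -> \int[mu]_x (c * w x)%:E = c%:E * \int[mu]_x (w x)%:E.
  move=> c0 m0 w0; rewrite -ge0_integralZl//.
  - exact/measurable_EFinP.
  - by move=> x _; rewrite lee_fin.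
have msq (c : R) (w : T -> R) : measurable_fun setT w ->
    measurable_fun setT (fun x => (c - h x) ^+ 2 * w x)%R.
  move=> mw; apply: measurable_funM => //; apply: measurable_funX.
  exact: measurable_funB.
have sq0 (c : R) (w : T -> R) : (forall x, 0 <= w x)%R ->
    forall x, (0 <= (c - h x) ^+ 2 * w x)%R.
  by move=> w0 x; rewrite mulr_ge0 ?sqr_ge0.
have muv : measurable_fun setT (fun x => u x + v x)%R by exact: measurable_funD.
have uv0 x : (0 <= u x + v x)%R by rewrite addr_ge0.
have mroots : measurable_fun setT (fun x => (Num.sqrt (u x) - Num.sqrt (v x)) ^+ 2)%R.
  by apply/measurable_funX/measurable_funB; exact: mroot.
pose w x : R := ((a - h x) ^+ 2 * u x + (b - h x) ^+ 2 * v x)%R.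
have mw : measurable_fun setT w by apply: measurable_funD; exact: msq.
have w0 x : (0 <= w x)%R by rewrite addr_ge0 ?sq0.
have Iw : \int[mu]_x (w x)%:E = D.
  rewrite ID; [|exact: msq|exact: msq|exact: sq0|exact: sq0].
  rewrite -(Pu (fun x => (a - h x) ^+ 2)%R); last 2 first.
  - by apply/measurable_funX/measurable_funB.
  - by move=> x; rewrite sqr_ge0.
  rewrite -(Qv (fun x => (b - h x) ^+ 2)%R)//.
  - by apply/measurable_funX/measurable_funB.
  - by move=> x; rewrite sqr_ge0.
have main s : (0 < s)%R ->
    (`|a - b| * 2)%:E <= (`|a - b| * H)%:E + (s%:E * D + (s^-1 * 2)%:E).
  move=> s0; have s0' := ltW s0; have si0 : (0 <= s^-1)%R by rewrite invr_ge0.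
  have Iuv : \int[mu]_x (u x + v x)%:E = 2%:E by rewrite ID// intu intv -EFinD.
  have mZ (c : R) (k : T -> R) : measurable_fun setT k ->
      measurable_fun setT (fun x => c * k x)%R by move=> mk; exact: measurable_funM.
  have kZ (c : R) (k : T -> R) : (0 <= c)%R -> (forall x, 0 <= k x)%R ->
      forall x, (0 <= c * k x)%R by move=> c0 k0 x; rewrite mulr_ge0.
  have root0 x : (0 <= (Num.sqrt (u x) - Num.sqrt (v x)) ^+ 2)%R by rewrite sqr_ge0.
  have -> : (`|a - b| * 2)%:E = \int[mu]_x (`|a - b| * (u x + v x))%:E.
    by rewrite IZ// Iuv EFinM.
  rewrite [X in X + _](_ : _ = \int[mu]_x
      (`|a - b| * (Num.sqrt (u x) - Num.sqrt (v x)) ^+ 2)%:E); last first.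
    by rewrite IZ// -HuvE EFinM.
  rewrite -Iw EFinM -Iuv -!IZ//.
  rewrite -!ID//; try by [exact: mZ|exact: kZ]; last 2 first.
  - by apply: measurable_funD; exact: mZ.
  - by move=> x; rewrite addr_ge0 ?mulr_ge0.
  apply: ge0_le_integral => //.
  - by move=> x _; rewrite lee_fin mulr_ge0.
  - by apply/measurable_EFinP; exact: mZ.
  - apply/measurable_EFinP; apply: measurable_funD; first exact: mZ.
    by apply: measurable_funD; exact: mZ.
  - move=> x _; rewrite lee_fin [(s^-1 * _)%R]mulrC.
    exact: hellinger_pointwise.
have rho0 : (0 < expR (- (r / 2)))%R := expR_gt0 _.
rewrite -/D; have [ab|ab] := eqVneq (a - b)%R 0%R.
  by rewrite ab expr0n mulr0 mule_ge0.
have ab0 : (0 < `|a - b|)%R by rewrite normr_gt0.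
case: (D) D0 main => [D'| |]// D0 main; last by rewrite mulry gtr0_sg// mul1e leey.
rewrite -EFinM lee_fin.
pose X : R := ((1 - H / 2) * `|a - b|)%R.
have X0 : (0 < X)%R by rewrite mulr_gt0// (lt_le_trans rho0).
(* the value of s that balances s * D' and 2 / s *)
have := main (2 / X)%R; rewrite divr_gt0// => /(_ isT).
rewrite -!EFinM -!EFinD lee_fin invf_div => le2.
have X2 : (X ^+ 2 <= 2 * D')%R.
  have : (2 * X <= 2 / X * D' + X)%R by move: le2; rewrite /X; lra.
  rewrite -(ler_pM2r X0).
  rewrite [leRHS](_ : _ = 2 * D' + X ^+ 2)%R; last by field; rewrite gt_eqF.
  by rewrite expr2; lra.
apply: le_trans X2.
rewrite /X exprMn real_normK ?num_real// ler_wpM2r ?sqr_ge0//.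
rewrite [leLHS](_ : _ = expR (- (r / 2)) ^+ 2)%R.
  by rewrite lerXn2r// nnegrE ltW// (lt_le_trans rho0).
by rewrite -expRM_natl; congr expR; field.
Qed.

End HellingerVariance.

(** * Spectral gap of the overlap matrix *)

(** Sum the hypothesis over all pairs of a class of size [s]: when the class sum
    of [g] vanishes, the left side is [2 s kappa sum g^2] and the right side is
    [4 s sum D], so the size of the class cancels. *)
Lemma class_variance (R : realType) n k (cl : 'I_n -> 'I_k) (kappa : R)
    (g D : 'I_n -> R) : (forall i j, cl i = cl j ->
    kappa * (g i - g j) ^+ 2 <= 2 * (D i + D j))%R ->
  (forall q, \sum_i (cl i == q)%:R * g i = 0)%R ->
  (kappa * \sum_i g i ^+ 2 <= 2 * \sum_i D i)%R.
Proof.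
move=> pair mean0; rewrite !mulr_sumr !(partition_big cl predT) //=.
apply: ler_sum => q _; rewrite -!mulr_sumr.
have [cl0|s0] := posnP #|[pred i | cl i == q]|.
  have e0 := card0_eq cl0.
  rewrite !big1 ?mulr0// => i iq; by have := e0 i; rewrite !inE iq.
set s := #|_| in s0.
have sR : (0 < s%:R :> R)%R by rewrite ltr0n.
have g0 : (\sum_(i | cl i == q) g i = 0)%R.
  rewrite -[RHS](mean0 q) big_mkcond; apply: eq_bigr => i _.
  by case: ifP => _; rewrite ?mul1r ?mul0r.
have cstS (c : R) : (\sum_(i | cl i == q) c = s%:R * c)%R.
  by rewrite sumr_const mulr_natl.
have : (\sum_(i | cl i == q) \sum_(j | cl j == q) kappa * (g i - g j) ^+ 2 <=
    \sum_(i | cl i == q) \sum_(j | cl j == q) 2 * (D i + D j))%R.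
  apply: ler_sum => i /eqP iq; apply: ler_sum => j /eqP jq.
  by apply: pair; rewrite iq jq.
have -> : (\sum_(i | cl i == q) \sum_(j | cl j == q) kappa * (g i - g j) ^+ 2 =
    2 * s%:R * (kappa * \sum_(i | cl i == q) g i ^+ 2))%R.
  transitivity (\sum_(i | cl i == q) (kappa * (s%:R * g i ^+ 2 +
      \sum_(j | cl j == q) g j ^+ 2)))%R.
    apply: eq_bigr => i _; rewrite -mulr_sumr; congr (_ * _)%R.
    transitivity (\sum_(j | cl j == q) (g i ^+ 2 + g j ^+ 2 - 2 * g i * g j))%R.
      by apply: eq_bigr => j _; ring.
    by rewrite sumrB big_split /= cstS -mulr_sumr g0 mulr0 subr0.
  by rewrite -mulr_sumr big_split /= cstS -mulr_sumr; ring.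
have -> : (\sum_(i | cl i == q) \sum_(j | cl j == q) 2 * (D i + D j) =
    2 * s%:R * (2 * \sum_(i | cl i == q) D i))%R.
  transitivity (\sum_(i | cl i == q) (2 * (s%:R * D i +
      \sum_(j | cl j == q) D j)))%R.
    by apply: eq_bigr => i _; rewrite -mulr_sumr big_split /= cstS.
  by rewrite -mulr_sumr big_split /= cstS -mulr_sumr; ring.
by rewrite ler_pM2l// mulr_gt0.
Qed.

Section OverlapForm.
Context d (T : measurableType d) (R : realType).
Variables (m : nat) (P : 'I_m.+1 -> probability T R) (f : 'I_m.+1 -> T -> R).
Local Notation Q := (uniform_mixture ord0 P).
Hypothesis Pf : forall i, has_density (P i) Q (f i).
Hypothesis f_sum : forall x, (\sum_i f i x = m.+1%:R)%R.

Let mf i : measurable_fun setT (f i). Proof. by case: (Pf i). Qed.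
Let f0 i x : (0 <= f i x)%R. Proof. by case: (Pf i). Qed.

Definition overlap_mean i j : R := (overlap P f i j / m.+1%:R)%R.

Definition overlap_form (g : 'I_m.+1 -> R) : R :=
  (\sum_i \sum_j g i * g j * overlap_mean i j)%R.

(** The conditional mean of [g] at a uniform index given an observation drawn
    from the distribution of that index. *)
Definition posterior_mean (g : 'I_m.+1 -> R) (x : T) : R :=
  ((\sum_i g i * f i x) / m.+1%:R)%R.

Lemma measurable_posterior_mean g : measurable_fun setT (posterior_mean g).
Proof.
apply: measurable_funM => //; apply: measurable_sum => i.
exact: measurable_funM.
Qed.

(** Up to the factor [m.+1], the form is the second moment of the posterior
    mean. *)
Lemma overlap_formE g :
  (overlap_form g)%:E = \int[Q]_x (m.+1%:R * posterior_mean g x ^+ 2)%:E.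
Proof.
have N0 : (m.+1%:R != 0 :> R)%R by rewrite pnatr_eq0.
have ffi i j : Q.-integrable setT (fun x => (f i x * f j x)%:E).
  apply/integrableP; split.
    by apply/measurable_EFinP; exact: measurable_funM.
  under eq_integral do rewrite gee0_abs ?lee_fin ?mulr_ge0//.
  by rewrite -(overlapE Pf f_sum) ltry.
transitivity (\int[Q]_x \sum_i \sum_j
    ((g i * g j / m.+1%:R)%:E * (f i x * f j x)%:E)); last first.
  apply: eq_integral => x _.
  under eq_bigr do rewrite sumEFin.
  rewrite sumEFin; congr _%:E; rewrite /posterior_mean.
  rewrite [RHS](_ : _ = (\sum_i g i * f i x) * (\sum_j g j * f j x) / m.+1%:R)%R.
    rewrite mulr_suml mulr_suml; apply: eq_bigr => i _.
    rewrite mulr_sumr mulr_suml; apply: eq_bigr => j _; ring.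
  by field.
rewrite integral_sum//; last first.
  by move=> i; apply: (integrable_sum measurableT) => j _; exact: integrableZl.
rewrite /overlap_form -sumEFin; apply: eq_bigr => i _.
rewrite integral_sum//; last by move=> j; exact: integrableZl.
rewrite -sumEFin; apply: eq_bigr => j _.
rewrite integralZl// -(overlapE Pf f_sum) -EFinM /overlap_mean.
by congr _%:E; ring.
Qed.

Definition within_variance (g : 'I_m.+1 -> R) i : \bar R :=
  \int[P i]_x ((g i - posterior_mean g x) ^+ 2)%:E.

(** The law of total variance: expected conditional variance plus second moment
    of the conditional mean. *)
Lemma within_variance_sum g :
  \sum_i within_variance g i + (overlap_form g)%:E = (\sum_i g i ^+ 2)%:E.
Proof.
have N0 : (m.+1%:R != 0 :> R)%R by rewrite pnatr_eq0.
have mh := measurable_posterior_mean g; set h := posterior_mean g in mh *.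
have msq i : measurable_fun setT (fun x => (g i - h x) ^+ 2)%R.
  by apply/measurable_funX/measurable_funB.
have mt i : measurable_fun setT (fun x => (g i - h x) ^+ 2 * f i x)%R.
  exact: measurable_funM.
have t0 i x : (0 <= (g i - h x) ^+ 2 * f i x)%R by rewrite mulr_ge0 ?sqr_ge0.
transitivity (\int[Q]_x ((\sum_i (g i - h x) ^+ 2 * f i x)%:E +
    (m.+1%:R * h x ^+ 2)%:E)).
  rewrite ge0_integralD//; last 4 first.
  - by move=> x _; rewrite lee_fin sumr_ge0.
  - by apply/measurable_EFinP; exact: measurable_sum.
  - by move=> x _; rewrite lee_fin mulr_ge0 ?sqr_ge0.
  - by apply/measurable_EFinP/measurable_funM => //; exact: measurable_funX.
  rewrite overlap_formE; congr (_ + _).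
  under [RHS]eq_integral do rewrite -sumEFin.
  rewrite ge0_integral_sum//; last 2 first.
  - by move=> i; apply/measurable_EFinP.
  - by move=> i x _; rewrite lee_fin.
  apply: eq_bigr => i _; rewrite /within_variance (density_integral (Pf i)).
  - by apply: eq_integral => x _; rewrite EFinM.
  - exact/measurable_EFinP.
  - by move=> x; rewrite lee_fin sqr_ge0.
transitivity (\int[Q]_x \sum_i ((g i ^+ 2)%:E * (f i x)%:E)).
  apply: eq_integral => x _; rewrite -EFinD sumEFin; congr _%:E.
  have hE : (\sum_i g i * f i x = m.+1%:R * h x)%R by rewrite /h /posterior_mean; field.
  transitivity (\sum_i g i ^+ 2 * f i x - 2 * h x * (\sum_i g i * f i x) +
      h x ^+ 2 * (\sum_i f i x) + m.+1%:R * h x ^+ 2)%R.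
    congr (_ + _)%R; rewrite !mulr_sumr -sumrB -big_split /=.
    by apply: eq_bigr => i _; ring.
  by rewrite f_sum hE; ring.
rewrite ge0_integral_sum//; last 2 first.
- by move=> i; apply/measurable_EFinP/measurable_funM.
- by move=> i x _; rewrite mule_ge0// lee_fin ?sqr_ge0.
rewrite -sumEFin; apply: eq_bigr => i _.
rewrite ge0_integralZl//; last 3 first.
- exact/measurable_EFinP.
- by move=> x _; rewrite lee_fin.
- by rewrite lee_fin sqr_ge0.
by rewrite (density_integral1 (Pf i)) mule1.
Qed.

Lemma within_variance_ge0 g i : 0 <= within_variance g i.
Proof. by apply: integral_ge0 => x _; rewrite lee_fin sqr_ge0. Qed.

Lemma overlap_form_bounds g : (0 <= overlap_form g <= \sum_i g i ^+ 2)%R.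
Proof.
apply/andP; split.
  rewrite -lee_fin overlap_formE; apply: integral_ge0 => x _.
  by rewrite lee_fin mulr_ge0 ?sqr_ge0.
rewrite -lee_fin -within_variance_sum leeDr//.
by apply: sume_ge0 => i _; exact: within_variance_ge0.
Qed.

(** Each class of distributions close in Renyi divergence forces variance
    within it, and the constraints make this variance the whole norm of [g]. *)
Lemma overlap_form_gap k (cl : 'I_m.+1 -> 'I_k) (r : R) g :
  (forall i j, cl i = cl j -> renyi_half (P i) (P j) <= r%:E) ->
  (forall q, \sum_i (cl i == q)%:R * g i = 0)%R ->
  (overlap_form g <= (1 - expR (- r) / 2) * \sum_i g i ^+ 2)%R.
Proof.
move=> cl_renyi mean0.
pose D i := fine (within_variance g i).
have DE i : (D i)%:E = within_variance g i.
  rewrite fineK// ge0_fin_numE ?within_variance_ge0//.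
  apply: (@le_lt_trans _ _ (\sum_i g i ^+ 2)%R%:E); last exact: ltry.
  rewrite -within_variance_sum (bigD1 i)//= -addeA leeDl// adde_ge0//.
    by apply: sume_ge0 => j _; exact: within_variance_ge0.
  by rewrite lee_fin; case/andP: (overlap_form_bounds g).
have D_sum : (\sum_i D i + overlap_form g = \sum_i g i ^+ 2)%R.
  apply: EFin_inj; rewrite EFinD -within_variance_sum; congr (_ + _).
  by rewrite -sumEFin; apply: eq_bigr => i _.
have := @class_variance R _ _ cl (expR (- r)) g D _ mean0.
rewrite -D_sum => H; have {H} : (expR (- r) * (\sum_i D i + overlap_form g) <=
    2 * \sum_i D i)%R.
  apply: H => i j ij; have := hellinger_variance (g i) (g j)
    (measurable_posterior_mean g) (cl_renyi i j ij).
  by rewrite -/(within_variance g i) -/(within_variance g j) -!DE -EFinD -EFinM lee_fin.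
by set S := (\sum_i D i)%R; set E := expR _; lra.
Qed.

Lemma overlap_trace :
  m.+1%:R%:E * (\sum_i overlap_mean i i)%:E = \sum_i (1 + chi2_div (P i) Q).
Proof.
under [RHS]eq_bigr do rewrite (chi2_div_density (Pf _)).
rewrite -EFinM mulr_sumr -sumEFin; apply: eq_bigr => i _.
rewrite /overlap_mean mulrC divfK ?pnatr_eq0// (overlapE Pf f_sum).
by apply: eq_integral => x _; rewrite expr2.
Qed.

End OverlapForm.

(** * The channel capacity bounds the trace *)

Section Capacity.
Context d (T : measurableType d) (R : realType).

Lemma chi2_div_ge0 (P Q : probability T R) : 0 <= chi2_div P Q.
Proof.
rewrite /chi2_div; case: asboolP => // _.
by apply: integral_ge0 => x _; rewrite expe2 -expe2 sqre_ge0.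
Qed.

(** Probability measures as a parameter space on which every function is
    measurable; priors with finite support only need this structure. *)
Definition discrete_probability := g_sigma_algebraType [set: set (probability T R)].

Lemma discrete_measurable (A : set discrete_probability) : measurable A.
Proof. exact: sub_sigma_algebra. Qed.

Lemma discrete_measurable_fun d' (T' : measurableType d')
  (k : discrete_probability -> T') : measurable_fun setT k.
Proof. by move=> _ Y _; exact: discrete_measurable. Qed.

(** The identity on [F], with the value [p0] elsewhere: if [p0] is in [F], the
    range is exactly [F]. *)
Definition parametrization (F : set (probability T R)) (p0 : probability T R)
    (theta : discrete_probability) : pprobability T R :=
  if `[< F theta >] then theta else p0.

HB.instance Definition _ F p0 :=
  isMeasurableFun.Build _ _ _ _ (parametrization F p0)
    (@discrete_measurable_fun _ _ (parametrization F p0)).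

Lemma range_parametrization F p0 : F p0 -> range (parametrization F p0) = F.
Proof.
move=> Fp0; apply/seteqP; split => [_ [theta _ <-]|p Fp].
  by rewrite /parametrization; case: asboolP.
by exists p => //; rewrite /parametrization asboolT.
Qed.

Lemma parametrizationE F p0 (p : probability T R) : F p ->
  parametrization F p0 p = p.
Proof. by move=> Fp; rewrite /parametrization asboolT. Qed.

Lemma chi2_div_eq (P Q Q' : probability T R) (f : T -> R) :
  has_density P Q f -> (forall A, measurable A -> Q A = Q' A) ->
  chi2_div P Q = chi2_div P Q'.
Proof.
move=> Pf QQ'; have intE A (k : T -> \bar R) : measurable A ->
    \int[Q]_(x in A) k x = \int[Q']_(x in A) k x.
  by move=> mA; apply: eq_measure_integral => B mB _; exact: QQ'.
have Pf' : has_density P Q' f.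
  by case: Pf => mf f0 Pf; split=> // A mA; rewrite Pf// intE.
have := chi2_div_density Pf; rewrite intE// -(chi2_div_density Pf').
have one : (1 : \bar R) \is a fin_num by [].
rewrite addeC [in RHS]addeC => /(congr1 (fun y => y - 1)).
by rewrite !addeK.
Qed.

(** The uniform prior on the given members of [F] is a competitor in the
    supremum. *)
Lemma capacity_ge m (P : 'I_m.+1 -> probability T R) (F : set (probability T R)) :
  (forall i, F (P i)) ->
  \sum_i chi2_div (P i) (uniform_mixture ord0 P) <=
    m.+1%:R%:E * chi2_capacity F.
Proof.
move=> FP.
pose rho : probability discrete_probability R :=
  uniform_mixture ord0 (fun i => \d_(P i : discrete_probability)).
pose par : {mfun discrete_probability >-> pprobability T R} := parametrization F (P ord0).
have intE (k : discrete_probability -> \bar R) : (forall x, 0 <= k x) ->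
    m.+1%:R%:E * \int[rho]_x k x = \sum_i k (P i).
  move=> k0; rewrite (integral_uniform_mixture _ (discrete_measurable_fun _) k0).
  apply: eq_bigr => i _; rewrite integral_dirac//; last exact: discrete_measurable_fun.
  by rewrite diracE mem_set// mul1e.
have N0 : (m.+1%:R%:E : \bar R) \is a fin_num by [].
have NP : 0 < (m.+1%:R%:E : \bar R) by rewrite lte_fin ltr0n.
have meanE A : measurable A -> uniform_mixture ord0 P A = prior_mean rho par A.
  move=> mA.
  have : m.+1%:R%:E * prior_mean rho par A = m.+1%:R%:E * uniform_mixture ord0 P A.
    rewrite uniform_mixtureE /prior_mean intE//.
    by apply: eq_bigr => i _; rewrite /par/= parametrizationE.
  move=> E; apply/eqP; rewrite eq_le.
  by apply/andP; split; rewrite -(lee_pmul2l N0 NP) E.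
have [f [Pf _]] := uniform_mixture_densities P.
pose div theta := chi2_div (par theta : probability T R) (prior_mean rho par).
have -> : \sum_i chi2_div (P i) (uniform_mixture ord0 P) =
    m.+1%:R%:E * \int[rho]_theta div theta.
  rewrite intE; last by move=> theta; exact: chi2_div_ge0.
  apply: eq_bigr => i _; rewrite /div /par /= parametrizationE//.
  exact: (chi2_div_eq (Pf i)).
rewrite lee_pmul2l//; apply: ereal_sup_ubound.
exists _, discrete_probability, par, rho; split => //.
- exact: range_parametrization.
- exact: discrete_measurable_fun.
Qed.

End Capacity.

(** * The main bound *)

Section Diameters.
Context d (T : measurableType d) (R : realType).
Implicit Types (F : set (probability T R)) (P Q : probability T R).

(** The squared Hellinger distance is nonnegative, so the logarithm is at most
    0. *)
Lemma renyi_half_ge0 P Q : 0 <= renyi_half P Q.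
Proof.
rewrite /renyi_half EFinN mulNe -muleN mule_ge0// oppe_ge0 lne_le0.
by rewrite -[leRHS]adde0 leeD2l// oppe_le0 mule_ge0 ?hellinger2_ge0// lee_fin.
Qed.

Lemma renyi_diameter_ge0 F : 0 <= renyi_diameter F.
Proof.
rewrite /renyi_diameter; case: asboolP => // /eqP/set0P[p Fp].
apply: (le_trans (renyi_half_ge0 p p)).
by apply: ereal_sup_ubound; exists (p, p).
Qed.

Lemma renyi_half_le_diameter F P Q : F P -> F Q ->
  renyi_half P Q <= renyi_diameter F.
Proof.
move=> FP FQ; rewrite /renyi_diameter; case: asboolP => [F0|_].
  by move: FP; rewrite F0.
by apply: ereal_sup_ubound; exists (P, Q).
Qed.

Lemma partition_diameter_ge0 k F : (0 < k)%N -> 0 <= partition_diameter k F.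
Proof.
case: k => // k _; apply: le_ereal_inf_tmp => _ [A _ <-].
apply: (le_trans (renyi_diameter_ge0 (A ord0))).
exact: (le_bigmax _ (fun i => renyi_diameter (A i))).
Qed.

(** An almost optimal partition; the slack between the infimum and [r] is
    absorbed in the constants. *)
Lemma partition_of_diameter k F (r : R) : partition_diameter k F < r%:E ->
  exists2 A : 'I_k -> set (probability T R), \bigcup_i A i = F &
    forall i P Q, A i P -> A i Q -> renyi_half P Q <= r%:E.
Proof.
move=> /ereal_inf_lt[_ [A [AF _] <-] Ar]; exists A => // i P Q AP AQ.
apply: (le_trans (renyi_half_le_diameter AP AQ)).
apply: (le_trans _ (ltW Ar)).
exact: (le_bigmax _ (fun i => renyi_diameter (A i))).
Qed.

End Diameters.

Lemma lne_le (R : realType) (x : \bar R) (M : R) :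
  x <= (expR M)%:E -> lne x <= M%:E.
Proof.
case: x => [r| |] // le; last by rewrite le0_lneNy ?leNye.
have [r0|r0] := leP r 0%R; first by rewrite le0_lneNy ?leNye// lee_fin.
by rewrite lne_EFin// lee_fin -[leRHS]expRK ler_ln ?posrE ?expR_gt0.
Qed.

Section MixtureBound.
Context d (T : measurableType d) (R : realType).
Variables (F : set (probability T R)) (n : nat) (c : R).
Hypotheses (n_ge2 : (2 <= n)%N) (FC : chi2_capacity F = c%:E) (c0 : (0 <= c)%R).

Definition truncated_diameter k : \bar R :=
  mine (partition_diameter k F) (ln n%:R)%:E.

Let X k : R := if k is 0 then 0%R else fine (truncated_diameter k).

Let ln_n_ge0 : (0 <= ln n%:R :> R)%R.
Proof. by rewrite ln_ge0// ler1n (leq_trans _ n_ge2). Qed.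

Lemma truncated_diameter_bounds k : (0 < k)%N ->
  0 <= truncated_diameter k <= (ln n%:R)%:E.
Proof.
move=> k0; rewrite /truncated_diameter ge_min lexx orbT andbT.
by rewrite le_min partition_diameter_ge0//= lee_fin.
Qed.

Lemma fine_truncated_diameter k : (0 < k)%N -> (X k)%:E = truncated_diameter k.
Proof.
case: k => // k _; rewrite /X fineK//.
have /andP[t0 tn] := @truncated_diameter_bounds k.+1 isT.
by rewrite ge0_fin_numE// (le_lt_trans tn)// ltry.
Qed.

(** In the second case the constraints are the vanishing class sums for a
    partition of diameter at most [X k + 1], and the factor 1/2 of the gap is
    absorbed by the last unit in the exponent. *)
Lemma truncated_diameter_gap m (P : 'I_m.+1 -> probability T R) f (k : 'I_m.+1) :
  (m < n)%N -> (forall i, F (P i)) ->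
  (forall i, has_density (P i) (uniform_mixture ord0 P) (f i)) ->
  (forall x, \sum_i f i x = m.+1%:R)%R -> (0 < k)%N ->
  (ln m.+1%:R <= X k)%R \/
    exists W : 'I_k -> 'I_m.+1 -> R, forall g,
      (forall q, \sum_i W q i * g i = 0)%R ->
      (overlap_form P f g <= (1 - expR (- (X k + 2))) * \sum_i g i ^+ 2)%R.
Proof.
move=> mn FP Pf f_sum k0.
have [le|lt] := leP (ln n%:R)%:E (partition_diameter k F).
  left; rewrite -lee_fin fine_truncated_diameter// /truncated_diameter min_r//.
  by rewrite lee_fin ler_ln ?posrE ?ltr0n ?ler_nat// (leq_trans _ n_ge2).
right; have XE : (X k)%:E = partition_diameter k F.
  by rewrite fine_truncated_diameter// /truncated_diameter min_l// ltW.
have /partition_of_diameter[A AF Ar] : partition_diameter k F < (X k + 1)%:E.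
  by rewrite -XE lte_fin ltrDl.
have /choice[cl clP] : forall i, exists l, A l (P i).
  by move=> i; have := FP i; rewrite -AF => -[l _ ?]; exists l.
exists (fun q i => (cl i == q)%:R%R) => g mean0.
have := @overlap_form_gap _ _ _ _ _ _ Pf f_sum _ cl (X k + 1) g _ mean0.
move=> gap; apply: (le_trans (gap _)) => [i j ij|].
  by apply: (Ar (cl i)) => //; rewrite ij.
apply: ler_wpM2r; first by apply: sumr_ge0 => i _; rewrite sqr_ge0.
rewrite lerD2l lerN2 (_ : - (X k + 2) = - (X k + 1) + - 1)%R; last by ring.
rewrite expRD ler_pM2l ?expR_gt0// expRN.
rewrite lef_pV2 ?posrE ?expR_gt0//.
by have := expR_ge1Dx (1 : R); lra.
Qed.

Lemma overlap_trace_le m (P : 'I_m.+1 -> probability T R) f :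
  (forall i, F (P i)) ->
  (forall i, has_density (P i) (uniform_mixture ord0 P) (f i)) ->
  (forall x, \sum_i f i x = m.+1%:R)%R ->
  (\sum_i overlap_mean P f i i <= c + 1)%R.
Proof.
move=> FP Pf f_sum; have N0 : (0 < m.+1%:R :> R)%R by rewrite ltr0n.
rewrite -(ler_pM2l N0) -lee_fin EFinM (overlap_trace Pf f_sum) big_split /=.
rewrite mulrDr mulr1 EFinD EFinM -FC [leRHS]addeC.
apply: leeD; last exact: capacity_ge.
by rewrite sumEFin lee_fin sumr_const card_ord.
Qed.

Lemma chi2_perm_mixture_le m (P : 'I_m.+1 -> probability T R)
    (K := (Num.truncn c).+1) :
  (m < n)%N -> (forall i, F (P i)) ->
  1 + chi2_div (perm_mixture P) (mean_field P) <=
    (expR (32 * (c + 1) + 4 * \sum_(1 <= k < K.+1) X k))%:E.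
Proof.
move=> mn FP; have [f [Pf f_sum]] := uniform_mixture_densities P.
rewrite (chi2_perm_mixture Pf f_sum) lee_fin.
have f0 i x : (0 <= f i x)%R by case: (Pf i).
have N0 : (m.+1%:R != 0 :> R)%R by rewrite pnatr_eq0.
have -> : (permanent (overlap P f) =
    m.+1%:R ^+ m.+1 * permanent (overlap_mean P f))%R.
  rewrite /permanent mulr_sumr; apply: eq_bigr => s _.
  rewrite /overlap_mean big_split /= prodr_const card_ord.
  by rewrite exprVn mulrCA divff ?mulr1// expf_neq0.
rewrite mulrA [(_^-1 * _)%R]mulrC; apply: permanent_exp_le.
- move=> i j; rewrite /overlap_mean /overlap; congr (fine _ / _)%R.
  by apply: eq_integral => x _; rewrite mulrC.
- move=> g; exact: (overlap_form_bounds Pf f_sum g).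
- exact: overlap_trace_le.
- exact: truncnS_gt.
- by rewrite -natr1 lerD2r truncn_le.
- move=> [|k]; first by [].
  rewrite -lee_fin fine_truncated_diameter//.
  by case/andP: (@truncated_diameter_bounds k.+1 isT).
- by move=> k /andP[k0 _]; exact: truncated_diameter_gap.
Qed.

Lemma lne_chi2_family_le (K := (Num.truncn c).+1) :
  lne (1 + chi2_family F n) <=
    (32 * (c + 1) + 4 * \sum_(1 <= k < K.+1) X k)%:E.
Proof.
apply: lne_le; set M := (32 * _ + _)%R.
have le : chi2_family F n <= (expR M - 1)%:E.
  apply: bigmax_le => [|m _]; first exact: leNye.
  apply: ge_ereal_sup => _ [P FP <-].
  have := chi2_perm_mixture_le (ltn_ord m) FP; rewrite -/M.
  by rewrite EFinB leeBrDl.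
rewrite [leRHS](_ : _ = 1 + (expR M - 1)%:E); first exact: leeD2l.
by rewrite -EFinD; congr _%:E; ring.
Qed.

Lemma chi2_family_bound :
  lne (1 + chi2_family F n) <=
    32%:E * (sum_upto_floor1 (chi2_capacity F) truncated_diameter
             + (chi2_capacity F + 1) * logp (lne (chi2_capacity F))).
Proof.
have X_ge0 k : (0 <= X k)%R.
  case: k => // k; rewrite -lee_fin fine_truncated_diameter//.
  by case/andP: (@truncated_diameter_bounds k.+1 isT).
have [L LE L1] : exists2 L : R, logp (lne c%:E) = L%:E & (1 <= L)%R.
  have e0 := expR_gt0 (1 : R).
  have [y yE ye] : exists2 y : R, maxe (lne c%:E) (expR 1)%:E = y%:E &
      (expR 1 <= y)%R.
    have [c0'|c0'] := leP c 0%R.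
      by exists (expR 1) => //; rewrite le0_lneNy ?lee_fin// maxNye.
    exists (Num.max (ln c) (expR 1)); last by rewrite le_max lexx orbT.
    by rewrite lne_EFin// EFin_max.
  exists (ln y); first by rewrite /logp yE lne_EFin// (lt_le_trans e0).
  by rewrite -[leLHS]expRK ler_ln ?posrE// (lt_le_trans e0).
apply: (le_trans lne_chi2_family_le); rewrite FC LE /=.
have -> : \sum_(1 <= k < (Num.truncn c).+2) truncated_diameter k =
    (\sum_(1 <= k < (Num.truncn c).+2) X k)%:E.
  rewrite -sumEFin; apply: eq_big_nat => k /andP[k1 _].
  by rewrite fine_truncated_diameter.
have : (0 <= \sum_(1 <= k < (Num.truncn c).+2) X k)%R by exact: sumr_ge0.
set S := (\sum_(1 <= k < _) X k)%R => S0.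
rewrite [leRHS](_ : _ = (32 * (S + (c + 1) * L))%:E) // lee_fin.
have : ((c + 1) * 1 <= (c + 1) * L)%R by rewrite ler_wpM2l// addr_ge0.
by lra.
Qed.

End MixtureBound.

(** If the capacity is infinite the right-hand side is infinite; otherwise the
    iterated logarithm is at least 1, and [chi2_family_bound] applies. *)
Theorem theorem1p7 (R : realType) :
  exists C : R, (0 < C)%R /\
    forall (d : measure_display) (T : measurableType d)
           (F : set (probability T R)) (n : nat),
      F !=set0 -> (2 <= n)%N ->
      lne (1 + chi2_family F n) <=
        C%:E * (sum_upto_floor1 (chi2_capacity F)
                  (fun k => mine (partition_diameter k F) (ln n%:R)%:E)
                + (chi2_capacity F + 1) * logp (lne (chi2_capacity F))).
Proof.
exists 32%R; split => // d T F n [p Fp] n2.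
have cap0 : 0 <= chi2_capacity F.
  have := @capacity_ge _ _ _ 0 (fun=> p) F (fun=> Fp).
  by rewrite mul1e big_ord1; apply: le_trans; exact: chi2_div_ge0.
case FC : (chi2_capacity F) cap0 => [c| |]// cap0.
  by rewrite -FC; apply: chi2_family_bound FC _.
rewrite [X in 32%:E * X](_ : _ = +oo); first by rewrite mulry gtr0_sg// mul1e leey.
rewrite [X in _ + X](_ : _ = +oo) ?addey//.
rewrite gt_eqF// (@lt_le_trans _ _ 0)//; apply: nneseries_ge0 => k k1 _.
by case/andP: (truncated_diameter_bounds F n2 k1).
Qed.
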